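(* Let $s\neq 1$ be a complex number with real part $\sigma=\Re(s)$, and let $x\geq 1$ be real. For $t\geq 1$ put $$R_s(t)=(s-1)\zeta(s)t^{s}-(s-1)\sum_{k\leq t}\Big(\frac{t}{k}\Big)^s-t-(s-1)\big(\{t\}-\tfrac12\big).$$ (i) One has $$\zeta(s)\bigg(\sum_{n\leq x}\frac{\mu(n)}{n^s}-\frac{m(x)}{x^{s-1}}\bigg)-1=\frac{s(\check{m}(x)-1)}{x^{s-1}}-\frac{(s-1)m_1(x)}{2x^{s-1}}+\frac{s-1}{x^{s}}+\frac{1}{x^{s-1}}\int_1^x m(x/t)\,R_s(t)\,\frac{dt}{t^2}.$$ (ii) If $\Re(s)>-1$, then for all $t\geq 1$, $$|R_s(t)|\leq\frac{|s+1|}{|\sigma+1|}\,\frac{|s-1|\,|s|}{6}\,\frac1t.$$ (iii) If $s=\sigma$ is real, $\sigma\neq 1$ and $\sigma>-1$, then $$\bigg|\sum_{n\leq x}\frac{\mu(n)}{n^\sigma}-\frac{1}{\zeta(\sigma)}-\frac{m(x)}{x^{\sigma-1}}\bigg|\leq\frac{|\sigma|\,|\sigma-1|}{8|\zeta(\sigma)|}\,\frac{1}{x^{\sigma-1}}\,\frac{1}{x^2}\int_1^x|m(t)|\,t\,dt+\frac{1}{|\zeta(\sigma)|\,x^{\sigma-1}}\bigg(\frac{|\sigma-1|}{2}|m_1(x)|+|\sigma|\,|\check{m}(x)-1|+\frac{|\sigma-1|}{x}\bigg).$$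
   Context: $\mu$ is the Möbius function, $\zeta$ the (meromorphically continued) Riemann zeta function, and $\{t\}$ the fractional part of $t$. For real $x\geq 1$: $m(x)=\sum_{n\leq x}\frac{\mu(n)}{n}$, $\check{m}(x)=\sum_{n\leq x}\frac{\mu(n)}{n}\log(x/n)$, and $m_1(x)=\frac1x\int_1^x m(t)\,dt$. *)

(* Defs.v *)
(* Stdlib reals with Coquelicot; from MathComp only the factorisation of
   natural numbers is used, under qualified names. *)
From Stdlib Require Import Reals List.
From Coquelicot Require Import Coquelicot.
From mathcomp Require prime.

Local Open Scope R_scope.

(* [Int_part x] is the floor of [x]; the sum is empty when [x < 1]. *)
Definition sum_le {G : AbelianMonoid} (f : nat -> G) (x : R) : G :=
  sum_n_m f 1 (Z.to_nat (Int_part x)).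

(* [prime.primes n] lists the distinct prime divisors of [n] and
   [prime.logn p n] is the p-adic valuation of [n].  Only [n >= 1] is
   meaningful. *)
Definition moebius (n : nat) : R :=
  if forallb (fun p => Nat.eqb (prime.logn p n) 1) (prime.primes n)
  then (-1) ^ length (prime.primes n)
  else 0.

Definition m (x : R) : R :=
  sum_le (G := R_AbelianMonoid) (fun n => moebius n / INR n) x.

Definition m_check (x : R) : R :=
  sum_le (G := R_AbelianMonoid)
    (fun n => moebius n / INR n * ln (x / INR n)) x.

Definition m1 (x : R) : R := / x * RInt m 1 x.

(* [t ^ s = exp (s ln t)] for a real base [t > 0] and a complex exponent. *)
Definition cpow (t : R) (s : C) : C :=
  (Rpower t (Re s) * cos (Im s * ln t), Rpower t (Re s) * sin (Im s * ln t)).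

Definition analytic_at (f : C -> C) (s0 : C) : Prop :=
  exists (a : nat -> C) (r : R), 0 < r /\
    forall s : C, Cmod (s - s0)%C < r ->
      is_pseries (K := C_AbsRing) (V := C_NormedModule) a (s - s0)%C (f s).

(* [zeta] is the analytic continuation to [C \ {1}] of the Dirichlet series
   [sum_{n >= 1} n^{-s}], [Re s > 1].  As [C \ {1}] is connected, this
   determines [zeta s] for every [s <> 1]; the value at the pole [1] is left
   unspecified. *)
Definition is_riemann_zeta (zeta : C -> C) : Prop :=
  (forall s : C, s <> RtoC 1 -> analytic_at zeta s) /\
  (forall s : C, 1 < Re s ->
     is_series (K := C_AbsRing) (V := C_NormedModule)
       (fun n : nat => cpow (INR (S n)) (- s)%C) (zeta s)).

Definition mu_sum (s : C) (x : R) : C :=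
  sum_le (G := C_AbelianMonoid)
    (fun n => (RtoC (moebius n) / cpow (INR n) s)%C) x.

Definition rem (zeta : C -> C) (s : C) (t : R) : C :=
  ((s - 1) * zeta s * cpow t s
   - (s - 1) * sum_le (G := C_AbelianMonoid) (fun k => cpow (t / INR k) s) t
   - RtoC t
   - (s - 1) * (RtoC (frac_part t) - / 2))%C.

(* Main.v *)
Require Import Defs.
From Stdlib Require Import ZArith Reals Lra Lia List Classical.
From Coquelicot Require Import Coquelicot.
From mathcomp Require ssreflect ssrbool eqtype ssrnat seq div prime.

(** Part (i) is an identity between finite sums.  Since [m (x / t)] is the sum of
    [mu n / n] over the [n] with [t <= x / n], the integral against [rem s t / t ^ 2]
    is a combination of the explicit integrals of [rem s t / t ^ 2] over
    [[1, x / n]] ([is_RInt_rem]).  These contain sums over [k <= x / n] of functions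
    of the product [n k], which Moebius inversion evaluates
    ([sum_moebius_convolution]).  The value [zeta s] enters linearly, through the
    single term [(s - 1) zeta s t ^ s] of [rem s t] ([zeta_mu_sum_identity]).

    Part (ii) is Euler-Maclaurin summation to second order.  Let
    [B2per u = {u} ^ 2 - {u}].  The integral of [B2per u * u ^ (- s - 2)] over
    [[1, y]], times [(s - 1) s (s + 1)], is explicit in terms of the sum of
    [k ^ (- s)] over [k <= y] ([is_RInt_B2per_cpow]).  For [Re s > 1], letting [y] tend
    to infinity gives
      [(s - 1) s (s + 1) F s = (s + 1) - 2 (s - 1) zeta s],
    where [F s] is the improper integral ([zeta_EM_right]).  That integral converges,
    and is analytic, for [Re s > -1]: expanding [u ^ (- z) = exp (- z ln u)] in powers
    of [z] under the integral sign costs an error which, uniformly in [u], is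
    [2 ^ (- n) u ^ (2 |z|)] ([exp_taylor_bound], [analytic_EM_integral]).  Both sides
    of the relation being analytic off [1], it extends to [Re s > -1]: any point there
    is joined to the half-plane [Re s > 1] by a line that misses [1], and on that line
    the difference of the two sides is a real-analytic function vanishing on a
    half-line ([real_analytic_identity], [zeta_EM]).  Then [rem s t] is
    [- (s - 1) s (s + 1) / 2 * t ^ s] times the integral of
    [(B2per u - B2per t) * u ^ (- s - 2)] over [u >= t]; as [B2per] takes its values in
    [[- 1 / 4, 0]], the bound holds even with [8] in place of [6] ([rem_bound]).

    Part (iii) divides (i) by [zeta sigma] and estimates the integral with the sharper
    constant [8].  The division requires [zeta sigma <> 0] for [sigma > -1], which the
    relation with [F] shows: [F sigma <= 0] because [B2per <= 0], and
    [(sigma + 1) |F sigma| <= 1 / 4] ([zeta_neq_0]).  The remaining integral of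
    [|m (x / t)| / t ^ 3] is brought to the form [|m t| t] by comparing the
    contributions of each jump of [|m|] ([is_RInt_abs_m_inv]). *)

Local Open Scope R_scope.

(** * Complex powers and complex-valued integrals *)

(** Sums over [C] carry the type of an abelian monoid structure, in which [ring] and [field]
    do not recognise [C]. *)
Ltac C_eq := match goal with |- ?a = ?b => change (@eq C a b) end.

Notation is_RInt_C := (is_RInt (V := C_R_NormedModule)).
Notation ex_RInt_C := (ex_RInt (V := C_R_NormedModule)).
Notation continuous_C := (continuous (T := R_UniformSpace) (U := C_UniformSpace)).
Notation sum_C := (sum_n_m (G := C_AbelianMonoid)).

Notation RInt_C := (RInt (V := C_R_CompleteNormedModule)).

Lemma C_ext (a b : C) : Re a = Re b -> Im a = Im b -> a = b.
Proof. destruct a, b; simpl; intros; subst; reflexivity. Qed.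

Lemma Re_mult (a b : C) : Re (a * b) = Re a * Re b - Im a * Im b.
Proof. reflexivity. Qed.

Lemma Im_mult (a b : C) : Im (a * b) = Re a * Im b + Im a * Re b.
Proof. reflexivity. Qed.

Lemma Im_le_Cmod (c : C) : Rabs (Im c) <= Cmod c.
Proof. apply Rle_trans with (2 := Rmax_Cmod c). apply Rmax_r. Qed.

Lemma RtoC_neq_0 (r : R) : r <> 0 -> RtoC r <> 0.
Proof. intros H E. apply H, RtoC_inj, E. Qed.

Lemma INR_ge_1 (k : nat) : (1 <= k)%nat -> 1 <= INR k.
Proof. intros H. apply le_INR in H. exact H. Qed.

(** The complex exponential; [cpow t s] is [cexp (s ln t)] for every real [t], which turns the
    laws of powers in the exponent into [cexp_plus]. *)
Definition cexp (w : C) : C := (exp (Re w) * cos (Im w), exp (Re w) * sin (Im w)).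

Lemma cpow_cexp (t : R) (s : C) : cpow t s = cexp (s * RtoC (ln t)).
Proof.
  unfold cpow, cexp, Rpower. rewrite Re_mult, Im_mult, re_RtoC, im_RtoC.
  apply C_ext; simpl; do 2 f_equal; ring.
Qed.

Lemma cexp_plus (a b : C) : cexp (a + b) = (cexp a * cexp b)%C.
Proof.
  unfold cexp. destruct a as [a1 a2], b as [b1 b2].
  apply C_ext; simpl; rewrite exp_plus.
  - rewrite cos_plus. ring.
  - rewrite sin_plus. ring.
Qed.

Lemma cexp_0 : cexp 0 = 1.
Proof. apply C_ext; simpl; rewrite exp_0, ?cos_0, ?sin_0; ring. Qed.

Lemma Cmod_cexp (w : C) : Cmod (cexp w) = exp (Re w).
Proof.
  unfold Cmod, cexp; simpl fst; simpl snd.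
  rewrite <- (sqrt_Rsqr (exp (Re w))) at 3 by (left; apply exp_pos).
  f_equal. generalize (sin2_cos2 (Im w)). unfold Rsqr. intros H.
  transitivity (exp (Re w) * exp (Re w) * (sin (Im w) * sin (Im w) + cos (Im w) * cos (Im w))).
  - ring.
  - rewrite H; ring.
Qed.

Lemma cpow_plus (t : R) (a b : C) : cpow t (a + b) = (cpow t a * cpow t b)%C.
Proof. rewrite !cpow_cexp, <- cexp_plus. f_equal. ring. Qed.

Lemma cpow_0 (t : R) : cpow t 0 = 1.
Proof. rewrite cpow_cexp, Cmult_0_l. apply cexp_0. Qed.

Lemma Cmod_cpow (t : R) (s : C) : Cmod (cpow t s) = Rpower t (Re s).
Proof.
  rewrite cpow_cexp, Cmod_cexp, Re_mult, re_RtoC, im_RtoC. unfold Rpower. f_equal; ring.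
Qed.

Lemma Rpower_pos (t y : R) : 0 < Rpower t y.
Proof. apply exp_pos. Qed.

Lemma cpow_neq_0 (t : R) (s : C) : cpow t s <> 0.
Proof. apply Cmod_gt_0. rewrite Cmod_cpow. apply Rpower_pos. Qed.

Lemma cpow_opp (t : R) (s : C) : cpow t (- s) = (/ cpow t s)%C.
Proof.
  assert (H : (cpow t (- s) * cpow t s)%C = 1).
  { rewrite <- cpow_plus, <- (cpow_0 t). f_equal. ring. }
  replace (cpow t (- s)) with (cpow t (- s) * cpow t s * / cpow t s)%C.
  - rewrite H. ring.
  - field. apply cpow_neq_0.
Qed.

Lemma cpow_1 (t : R) : 0 < t -> cpow t 1 = t.
Proof.
  intros Ht. unfold cpow. simpl. rewrite Rpower_1 by easy.
  rewrite Rmult_0_l, cos_0, sin_0. apply C_ext; simpl; ring.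
Qed.

Lemma cpow_S (t : R) (s : C) : 0 < t -> cpow t s = (cpow t (s - 1) * RtoC t)%C.
Proof.
  intros Ht. rewrite <- (cpow_1 t Ht) at 1. rewrite <- cpow_plus. f_equal. ring.
Qed.

Lemma cpow_real (t y : R) : cpow t y = Rpower t y.
Proof. unfold cpow. simpl. rewrite Rmult_0_l, cos_0, sin_0. apply C_ext; simpl; ring. Qed.

Lemma cpow_1_l (s : C) : cpow 1 s = 1.
Proof. rewrite cpow_cexp, ln_1, Cmult_0_r. apply cexp_0. Qed.

Lemma cpow_mult_l (a b : R) (s : C) :
  0 < a -> 0 < b -> cpow (a * b) s = (cpow a s * cpow b s)%C.
Proof.
  intros. rewrite !cpow_cexp, ln_mult, RtoC_plus, <- cexp_plus by easy. f_equal. ring.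
Qed.

Lemma cpow_div_l (a b : R) (s : C) :
  0 < a -> 0 < b -> cpow (a / b) s = (cpow a s / cpow b s)%C.
Proof.
  intros Ha Hb. replace (cpow a s) with (cpow (a / b * b) s) by (f_equal; field; lra).
  rewrite (cpow_mult_l (a / b)); try easy.
  - field. apply cpow_neq_0.
  - now apply Rdiv_lt_0_compat.
Qed.

Lemma is_derive_pair (f g : R -> R) (t a b : R) :
  is_derive f t a -> is_derive g t b ->
  is_derive (K := R_AbsRing) (V := C_R_NormedModule) (fun u => (f u, g u)) t (a, b).
Proof.
  intros Hf Hg.
  apply is_derive_ext with (fun u => plus (G := C_R_NormedModule)
    (scal (f u) (1, 0)) (scal (g u) (0, 1))).
  { intros u. apply C_ext; compute; ring. }
  replace (a, b) with (plus (G := C_R_NormedModule) (scal a (1, 0)) (scal b (0, 1)))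
    by (apply C_ext; compute; ring).
  apply @is_derive_plus; now apply @is_derive_scal_l.
Qed.

Lemma continuous_pair (f g : R -> R) (t : R) :
  continuous f t -> continuous g t -> continuous_C (fun u => (f u, g u)) t.
Proof.
  intros Hf Hg.
  apply continuous_ext with (fun u => plus (G := C_R_NormedModule)
    (scal (f u) (1, 0)) (scal (g u) (0, 1))).
  { intros u. apply C_ext; compute; ring. }
  apply (@continuous_plus _ _ C_R_NormedModule);
    now apply (@continuous_scal_l _ _ C_R_NormedModule).
Qed.

Lemma continuous_Re (f : R -> C) (t : R) :
  continuous_C f t -> continuous (fun u => Re (f u)) t.
Proof.
  intros H. apply (continuous_comp f fst); trivial.
  destruct (f t). apply continuous_fst.
Qed.

Lemma continuous_Im (f : R -> C) (t : R) :
  continuous_C f t -> continuous (fun u => Im (f u)) t.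
Proof.
  intros H. apply (continuous_comp f snd); trivial.
  destruct (f t). apply continuous_snd.
Qed.

Lemma continuous_Cmult (f g : R -> C) (t : R) :
  continuous_C f t -> continuous_C g t -> continuous_C (fun u => (f u * g u)%C) t.
Proof.
  intros Hf Hg.
  generalize (continuous_Re _ _ Hf) (continuous_Im _ _ Hf)
             (continuous_Re _ _ Hg) (continuous_Im _ _ Hg); intros H1 H2 H3 H4.
  apply continuous_pair.
  - apply (continuous_minus (V := R_NormedModule)); now apply (continuous_mult (K := R_AbsRing)).
  - apply (continuous_plus (V := R_NormedModule)); now apply (continuous_mult (K := R_AbsRing)).
Qed.

Lemma continuous_RtoC (f : R -> R) (t : R) :
  continuous f t -> continuous_C (fun u => RtoC (f u)) t.
Proof. intros H. apply continuous_pair; trivial. apply continuous_const. Qed.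

Lemma continuous_Cpow (f : R -> C) (n : nat) (t : R) :
  continuous_C f t -> continuous_C (fun u => (f u ^ n)%C) t.
Proof.
  intros Hf. induction n; simpl; [apply continuous_const | now apply continuous_Cmult].
Qed.

Lemma is_derive_cexp (w : C) (t : R) :
  is_derive (K := R_AbsRing) (V := C_R_NormedModule)
    (fun u => cexp (w * RtoC u)) t (w * cexp (w * RtoC t))%C.
Proof.
  destruct w as [a b].
  apply is_derive_ext with (fun u : R => (exp (a * u) * cos (b * u), exp (a * u) * sin (b * u))).
  { intros u. unfold cexp; apply C_ext; simpl; do 2 f_equal; ring. }
  match goal with |- is_derive _ _ ?l => replace l with
    (a * exp (a * t) * cos (b * t) - b * exp (a * t) * sin (b * t),
     a * exp (a * t) * sin (b * t) + b * exp (a * t) * cos (b * t)) end.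
  - apply is_derive_pair; auto_derive; trivial; ring.
  - unfold cexp; apply C_ext; simpl;
      rewrite ?Rmult_0_r, ?Rminus_0_r, ?Rplus_0_l; ring.
Qed.

Lemma is_derive_cpow (s : C) (t : R) : 0 < t ->
  is_derive (K := R_AbsRing) (V := C_R_NormedModule)
    (fun u => cpow u s) t (s * cpow t (s - 1))%C.
Proof.
  intros Ht.
  replace (s * cpow t (s - 1))%C
    with (scal (V := C_R_NormedModule) (/ t) (s * cexp (s * RtoC (ln t)))%C).
  - apply is_derive_ext with (fun u => cexp (s * RtoC (ln u))).
    { intros; symmetry; apply cpow_cexp. }
    apply (is_derive_comp (V := C_R_NormedModule) (fun u => cexp (s * RtoC u)) ln).
    + apply is_derive_cexp.
    + auto_derive; trivial. field; lra.
  - rewrite scal_R_Cmult, <- cpow_cexp. unfold Cminus.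
    rewrite cpow_plus, cpow_opp, cpow_1, RtoC_inv by lra. C_eq. ring.
Qed.

Lemma continuous_cpow (s : C) (t : R) : 0 < t -> continuous_C (fun u => cpow u s) t.
Proof.
  intros Ht. apply (ex_derive_continuous (V := C_R_NormedModule)).
  eexists. now apply is_derive_cpow.
Qed.

Lemma is_RInt_C_plus (f g : R -> C) (a b : R) (l k : C) :
  is_RInt_C f a b l -> is_RInt_C g a b k -> is_RInt_C (fun t => (f t + g t)%C) a b (l + k)%C.
Proof. apply (is_RInt_plus (V := C_R_NormedModule)). Qed.

Lemma is_RInt_C_minus (f g : R -> C) (a b : R) (l k : C) :
  is_RInt_C f a b l -> is_RInt_C g a b k -> is_RInt_C (fun t => (f t - g t)%C) a b (l - k)%C.
Proof. apply (is_RInt_minus (V := C_R_NormedModule)). Qed.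

Lemma is_RInt_C_ext (f g : R -> C) (a b : R) (l : C) : a <= b ->
  (forall t, a < t < b -> f t = g t) -> is_RInt_C f a b l -> is_RInt_C g a b l.
Proof.
  intros Hab H. apply (is_RInt_ext (V := C_R_NormedModule)).
  now rewrite Rmin_left, Rmax_right by easy.
Qed.

Lemma is_RInt_C_0 (a b : R) : is_RInt_C (fun _ => RtoC 0) a b (RtoC 0).
Proof.
  generalize (is_RInt_const (V := C_R_NormedModule) a b (RtoC 0)).
  now rewrite scal_R_Cmult, Cmult_0_r.
Qed.

Lemma is_RInt_Cmult_l (c : C) (f : R -> C) (a b : R) (l : C) :
  is_RInt_C f a b l -> is_RInt_C (fun t => (c * f t)%C) a b (c * l)%C.
Proof.
  intros H.
  generalize (is_RInt_fct_extend_fst (U := R_NormedModule) (V := R_NormedModule) _ _ _ _ H)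
    (is_RInt_fct_extend_snd (U := R_NormedModule) (V := R_NormedModule) _ _ _ _ H).
  intros H1 H2.
  apply (is_RInt_fct_extend_pair (U := R_NormedModule) (V := R_NormedModule)); simpl.
  - apply (is_RInt_minus (V := R_NormedModule)); now apply (is_RInt_scal (V := R_NormedModule)).
  - apply (is_RInt_plus (V := R_NormedModule)); now apply (is_RInt_scal (V := R_NormedModule)).
Qed.

Lemma is_RInt_RtoC (f : R -> R) (a b l : R) :
  is_RInt f a b l -> is_RInt_C (fun t => RtoC (f t)) a b (RtoC l).
Proof.
  intros H.
  apply (is_RInt_fct_extend_pair (U := R_NormedModule) (V := R_NormedModule)); simpl; trivial.
  generalize (is_RInt_const (V := R_NormedModule) a b 0).
  unfold scal; simpl; unfold mult; simpl. now rewrite Rmult_0_r.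
Qed.

Lemma is_RInt_Re (f : R -> C) (a b : R) (l : C) :
  is_RInt_C f a b l -> is_RInt (fun t => Re (f t)) a b (Re l).
Proof. apply (is_RInt_fct_extend_fst (U := R_NormedModule) (V := R_NormedModule)). Qed.

(** Subtracting integrals with a common left end is how tails of an integral from [1] are
    obtained. *)
Lemma is_RInt_C_between (g : R -> C) (a b c : R) (l k : C) :
  is_RInt_C g a b l -> is_RInt_C g a c k -> is_RInt_C g b c (k - l)%C.
Proof.
  intros Hl Hk. replace (k - l)%C with (plus (G := C_R_NormedModule) (opp l) k).
  - apply (is_RInt_Chasles (V := C_R_NormedModule)) with a; trivial.
    now apply (is_RInt_swap (V := C_R_NormedModule)).
  - unfold Cminus. rewrite Cplus_comm. reflexivity.
Qed.

Lemma RInt_C_correct (g : R -> C) (a b : R) :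
  ex_RInt_C g a b -> is_RInt_C g a b (RInt_C g a b).
Proof. apply (RInt_correct (V := C_R_CompleteNormedModule)). Qed.

Lemma is_RInt_C_unique (g : R -> C) (a b : R) (l : C) : is_RInt_C g a b l -> RInt_C g a b = l.
Proof. apply (is_RInt_unique (V := C_R_CompleteNormedModule)). Qed.

Lemma ex_RInt_C_continuous (g : R -> C) (a b : R) : 1 <= a -> a <= b ->
  (forall u, 1 <= u -> continuous_C g u) -> ex_RInt_C g a b.
Proof.
  intros Ha Hab Hg. apply (ex_RInt_continuous (V := C_R_CompleteNormedModule)).
  rewrite Rmin_left, Rmax_right by easy. intros u Hu. apply Hg. lra.
Qed.

Lemma Cmod_RInt_le (f : R -> C) (g : R -> R) (a b : R) (l : C) (lg : R) :
  a <= b -> (forall x, a <= x <= b -> Cmod (f x) <= g x) ->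
  is_RInt_C f a b l -> is_RInt g a b lg -> Cmod l <= lg.
Proof.
  intros Hab H Hf Hg. rewrite Cmod_norm.
  apply (norm_RInt_le f g a b l lg Hab); trivial.
  intros x Hx. rewrite <- Cmod_norm. auto.
Qed.

(** The factor [s] is kept on the left so that [s = 0] needs no separate treatment: this
    form is used with the exponents [s - 1], [1 - s], [- s] and [- s - 1], any of which may vanish. *)
Lemma is_RInt_cpow (s : C) (a b : R) : 0 < a -> 0 < b ->
  is_RInt_C (fun t => (s * cpow t (s - 1))%C) a b (cpow b s - cpow a s)%C.
Proof.
  intros Ha Hb.
  assert (H : forall x, Rmin a b <= x <= Rmax a b -> 0 < x).
  { intros x [H _]. apply Rlt_le_trans with (2 := H). now apply Rmin_glb_lt. }
  apply (is_RInt_derive (V := C_R_CompleteNormedModule) (fun t => cpow t s)).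
  - intros x Hx. apply is_derive_cpow. auto.
  - intros x Hx. apply continuous_Cmult. apply continuous_const. apply continuous_cpow. auto.
Qed.

Lemma is_RInt_Rpower (y a b : R) : 0 < a -> 0 < b -> y <> 0 ->
  is_RInt (fun t => Rpower t (y - 1)) a b ((Rpower b y - Rpower a y) / y).
Proof.
  intros Ha Hb Hy.
  generalize (is_RInt_Re _ _ _ _ (is_RInt_cpow (RtoC y) a b Ha Hb)); intros H.
  apply (is_RInt_scal (V := R_NormedModule)) with (k := / y) in H.
  eapply (is_RInt_ext (V := R_NormedModule)) in H.
  - replace ((Rpower b y - Rpower a y) / y) with
      (scal (/ y) (Re (cpow b y - cpow a y)%C)); [exact H|].
    rewrite !cpow_real, <- RtoC_minus, re_RtoC. unfold scal; simpl; unfold mult; simpl. field; easy.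
  - intros x _. rewrite <- RtoC_minus, cpow_real, <- RtoC_mult, re_RtoC.
    unfold scal; simpl; unfold mult; simpl. field; easy.
Qed.

Lemma is_RInt_inv (a b : R) : 0 < a -> 0 < b -> is_RInt (fun t => / t) a b (ln b - ln a).
Proof.
  intros Ha Hb.
  assert (H : forall x, Rmin a b <= x <= Rmax a b -> 0 < x).
  { intros x [H _]. apply Rlt_le_trans with (2 := H). now apply Rmin_glb_lt. }
  apply (is_RInt_derive (V := R_CompleteNormedModule) ln).
  - intros x Hx. specialize (H x Hx). auto_derive; trivial. field; lra.
  - intros x Hx. specialize (H x Hx). apply (ex_derive_continuous (V := R_NormedModule)). auto_derive. lra.
Qed.

Lemma is_RInt_inv_sqr (a b : R) : 0 < a -> 0 < b ->
  is_RInt (fun t => / t ^ 2) a b (/ a - / b).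
Proof.
  intros Ha Hb.
  assert (H : forall x, Rmin a b <= x <= Rmax a b -> 0 < x).
  { intros x [H _]. apply Rlt_le_trans with (2 := H). now apply Rmin_glb_lt. }
  replace (/ a - / b) with (- / b - - / a) by ring.
  apply (is_RInt_derive (V := R_CompleteNormedModule) (fun t => - / t)).
  - intros x Hx. specialize (H x Hx). auto_derive; [lra |]. field; lra.
  - intros x Hx. specialize (H x Hx). apply (ex_derive_continuous (V := R_NormedModule)). auto_derive.
    assert (0 < x * x) by nra. lra.
Qed.

Lemma is_RInt_inv_cube (b : R) : 1 <= b ->
  is_RInt (fun t => / t ^ 3) 1 b (/ 2 * (1 - / b ^ 2)).
Proof.
  intros Hb.
  replace (/ 2 * (1 - / b ^ 2)) with (- / (2 * b ^ 2) - - / (2 * 1 ^ 2)) by (field; lra).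
  assert (H : forall x, Rmin 1 b <= x <= Rmax 1 b -> 0 < x).
  { intros x. rewrite Rmin_left by easy. lra. }
  apply (is_RInt_derive (V := R_CompleteNormedModule) (fun t => - / (2 * t ^ 2))).
  - intros t Ht. specialize (H t Ht). auto_derive.
    + assert (0 < t * t) by nra. lra.
    + field. lra.
  - intros t Ht. specialize (H t Ht). apply (ex_derive_continuous (V := R_NormedModule)). auto_derive.
    assert (0 < t * t) by nra. assert (0 < t * (t * t)) by nra. lra.
Qed.

Lemma is_RInt_id (a b : R) : is_RInt (fun t => t) a b ((b ^ 2 - a ^ 2) / 2).
Proof.
  replace ((b ^ 2 - a ^ 2) / 2) with (b ^ 2 / 2 - a ^ 2 / 2) by field.
  apply (is_RInt_derive (V := R_CompleteNormedModule) (fun t => t ^ 2 / 2)).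
  - intros t _. auto_derive; trivial. field.
  - intros t _. apply continuous_id.
Qed.

Lemma is_RInt_pow (n : nat) (b : R) : is_RInt (fun v => v ^ n) 0 b (b ^ S n / INR (S n)).
Proof.
  assert (Hn : INR (S n) <> 0) by (apply not_0_INR; lia).
  replace (b ^ S n / INR (S n)) with (b ^ S n / INR (S n) - 0 ^ S n / INR (S n))
    by (rewrite pow_i by lia; field; trivial).
  apply (is_RInt_derive (V := R_CompleteNormedModule) (fun v => v ^ S n / INR (S n))).
  - intros v _. auto_derive; trivial. simpl Nat.pred. field; trivial.
  - intros v _. apply (ex_derive_continuous (V := R_NormedModule)). auto_derive. trivial.
Qed.

(** * Integer parts and finite complex sums *)

(** The upper summation limit in [sum_le]. *)
Definition floor_nat (x : R) : nat := Z.to_nat (Int_part x).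

Lemma floor_nat_bounds (x : R) : 0 <= x -> INR (floor_nat x) <= x < INR (floor_nat x) + 1.
Proof.
  intros Hx. unfold floor_nat. destruct (base_Int_part x) as [H1 H2].
  assert (H : (0 <= Int_part x)%Z).
  { apply Z.lt_succ_r. apply lt_IZR. rewrite succ_IZR. lra. }
  rewrite INR_IZR_INZ, Z2Nat.id by easy. lra.
Qed.

Lemma le_floor_nat (k : nat) (x : R) : 0 <= x -> (k <= floor_nat x)%nat <-> INR k <= x.
Proof.
  intros Hx. destruct (floor_nat_bounds x Hx) as [H1 H2]. split; intros H.
  - apply le_INR in H. lra.
  - apply Nat.lt_succ_r, INR_lt. rewrite S_INR. lra.
Qed.

Lemma floor_nat_unique (n : nat) (x : R) : INR n <= x < INR n + 1 -> floor_nat x = n.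
Proof.
  intros H. assert (Hx : 0 <= x) by (generalize (pos_INR n); lra).
  apply Nat.le_antisymm.
  - apply Nat.lt_succ_r, INR_lt. rewrite S_INR. generalize (floor_nat_bounds x Hx); lra.
  - apply le_floor_nat; lra.
Qed.

Lemma floor_nat_INR (n : nat) : floor_nat (INR n) = n.
Proof. apply floor_nat_unique. lra. Qed.

Lemma frac_part_floor_nat (x : R) : 0 <= x -> frac_part x = x - INR (floor_nat x).
Proof.
  intros Hx. destruct (floor_nat_bounds x Hx) as [H1 H2].
  symmetry. apply (Int_part_frac_part_spec x (Z.of_nat (floor_nat x))).
  - lra.
  - rewrite <- INR_IZR_INZ. lra.
Qed.

Lemma floor_nat_div (x : R) (n : nat) : 0 <= x -> (1 <= n)%nat ->
  floor_nat (x / INR n) = (floor_nat x / n)%nat.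
Proof.
  intros Hx Hn. destruct (floor_nat_bounds x Hx) as [H1 H2].
  assert (Hn' := INR_ge_1 n Hn).
  apply floor_nat_unique. rewrite <- S_INR, <- Rle_div_r, Rlt_div_l by lra.
  assert (E := Nat.div_mod_eq (floor_nat x) n).
  assert (L := Nat.mod_upper_bound (floor_nat x) n ltac:(lia)).
  rewrite <- !mult_INR. split.
  - apply Rle_trans with (2 := H1). apply le_INR. lia.
  - apply Rlt_le_trans with (1 := H2). rewrite <- S_INR. apply le_INR. nia.
Qed.

Lemma sum_C_S (f : nat -> C) (n : nat) : sum_C f 1 (S n) = (sum_C f 1 n + f (S n))%C.
Proof. apply (sum_n_Sm (G := C_AbelianMonoid)). lia. Qed.

Lemma sum_C_0 (f : nat -> C) : sum_C f 1 0 = RtoC 0.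
Proof. apply (sum_n_m_zero (G := C_AbelianMonoid)). lia. Qed.

Lemma sum_C_ext (f g : nat -> C) (n : nat) :
  (forall k, (1 <= k <= n)%nat -> f k = g k) -> sum_C f 1 n = sum_C g 1 n.
Proof. apply (sum_n_m_ext_loc (G := C_AbelianMonoid)). Qed.

Lemma sum_C_mult_l (c : C) (f : nat -> C) (n : nat) :
  sum_C (fun k => (c * f k)%C) 1 n = (c * sum_C f 1 n)%C.
Proof. apply (sum_n_m_mult_l (K := C_Ring)). Qed.

Lemma sum_C_mult_r (c : C) (f : nat -> C) (n : nat) :
  sum_C (fun k => (f k * c)%C) 1 n = (sum_C f 1 n * c)%C.
Proof. apply (sum_n_m_mult_r (K := C_Ring)). Qed.

Lemma sum_C_plus (f g : nat -> C) (n : nat) :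
  sum_C (fun k => (f k + g k)%C) 1 n = (sum_C f 1 n + sum_C g 1 n)%C.
Proof. apply (sum_n_m_plus (G := C_AbelianMonoid)). Qed.

Lemma sum_C_minus (f g : nat -> C) (n : nat) :
  sum_C (fun k => (f k - g k)%C) 1 n = (sum_C f 1 n - sum_C g 1 n)%C.
Proof. induction n; [rewrite !sum_C_0 | rewrite !sum_C_S, IHn]; C_eq; ring. Qed.

Lemma RtoC_sum (f : nat -> R) (n : nat) :
  RtoC (sum_n_m (G := R_AbelianMonoid) f 1 n) = sum_C (fun k => RtoC (f k)) 1 n.
Proof.
  induction n.
  - now rewrite sum_C_0, sum_n_m_zero by lia.
  - rewrite sum_C_S, <- IHn, sum_n_Sm by lia. apply RtoC_plus.
Qed.

Lemma sum_C_const (c : C) (n : nat) : sum_C (fun _ => c) 1 n = (RtoC (INR n) * c)%C.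
Proof.
  induction n; [rewrite sum_C_0; simpl; C_eq; ring |].
  rewrite sum_C_S, IHn, S_INR, RtoC_plus. C_eq. ring.
Qed.

Lemma RtoC_floor_nat (t : R) : RtoC (INR (floor_nat t)) = sum_C (fun _ => RtoC 1) 1 (floor_nat t).
Proof. rewrite sum_C_const. C_eq. ring. Qed.

Lemma sum_C_extend (f : nat -> C) (n m : nat) :
  (n <= m)%nat -> (forall k, (n < k <= m)%nat -> f k = RtoC 0) -> sum_C f 1 m = sum_C f 1 n.
Proof.
  induction m; intros Hnm Hf.
  - now replace n with 0%nat by lia.
  - destruct (Nat.eq_dec n (S m)) as [-> | Hn]; trivial.
    rewrite sum_C_S, (Hf (S m)), IHm; try lia; [C_eq; ring |].
    intros; apply Hf; lia.
Qed.

Lemma sum_C_switch (f : nat -> nat -> C) (n m : nat) :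
  sum_C (fun i => sum_C (f i) 1 m) 1 n = sum_C (fun j => sum_C (fun i => f i j) 1 n) 1 m.
Proof.
  induction n.
  - rewrite sum_C_0. symmetry. rewrite (sum_C_extend _ 0 m) by (lia || (intros; apply sum_C_0)).
    apply sum_C_0.
  - rewrite sum_C_S, IHn, <- sum_C_plus. apply sum_C_ext. intros; symmetry; apply sum_C_S.
Qed.

(** * Integrals of step functions against a weight *)

Lemma is_RInt_sum_C (f : nat -> R -> C) (l : nat -> C) (a b : R) (n : nat) :
  (forall k, (1 <= k <= n)%nat -> is_RInt_C (f k) a b (l k)) ->
  is_RInt_C (fun u => sum_C (fun k => f k u) 1 n) a b (sum_C l 1 n).
Proof.
  induction n; intros H.
  - rewrite sum_C_0. apply (is_RInt_ext (V := C_R_NormedModule)) with (fun _ => RtoC 0).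
    + intros; symmetry; apply sum_C_0.
    + apply is_RInt_C_0.
  - rewrite sum_C_S.
    apply (is_RInt_ext (V := C_R_NormedModule)) with
      (fun u => plus (G := C_R_NormedModule) (sum_C (fun k => f k u) 1 n) (f (S n) u)).
    + intros; symmetry; apply sum_C_S.
    + apply (is_RInt_plus (V := C_R_NormedModule)); [apply IHn; intros; apply H; lia | apply H; lia].
Qed.

Lemma is_RInt_indicator_ge (g : R -> C) (a c b : R) (l : C) : a <= c <= b ->
  is_RInt_C g c b l -> is_RInt_C (fun u => if Rle_dec c u then g u else RtoC 0) a b l.
Proof.
  intros [Hac Hcb] H.
  replace l with (plus (G := C_R_NormedModule) (RtoC 0) l) by (apply (plus_zero_l (G := C_R_NormedModule))).
  apply (is_RInt_Chasles (V := C_R_NormedModule)) with c.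
  - apply (is_RInt_ext (V := C_R_NormedModule)) with (2 := is_RInt_C_0 a c).
    rewrite Rmax_right by lra. intros u Hu. destruct (Rle_dec c u); trivial. lra.
  - apply (is_RInt_ext (V := C_R_NormedModule)) with (2 := H).
    rewrite Rmin_left by lra. intros u Hu. destruct (Rle_dec c u); trivial. lra.
Qed.

Lemma is_RInt_indicator_le (g : R -> C) (a c b : R) (l : C) : a <= c <= b ->
  is_RInt_C g a c l -> is_RInt_C (fun u => if Rle_dec u c then g u else RtoC 0) a b l.
Proof.
  intros [Hac Hcb] H.
  replace l with (plus (G := C_R_NormedModule) l (RtoC 0)) by (apply (plus_zero_r (G := C_R_NormedModule))).
  apply (is_RInt_Chasles (V := C_R_NormedModule)) with c.
  - apply (is_RInt_ext (V := C_R_NormedModule)) with (2 := H).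
    rewrite Rmax_right by lra. intros u Hu. destruct (Rle_dec u c); trivial. lra.
  - apply (is_RInt_ext (V := C_R_NormedModule)) with (2 := is_RInt_C_0 c b).
    rewrite Rmin_left by lra. intros u Hu. destruct (Rle_dec u c); trivial. lra.
Qed.

(** Turns a sum whose length varies with the integration variable into a sum of fixed length,
    which can be integrated term by term. *)
Lemma sum_C_indicator (c : nat -> C) (z : C) (P : nat -> Prop) (dec : forall k, {P k} + {~ P k})
  (n N : nat) : (n <= N)%nat -> (forall k, (1 <= k <= N)%nat -> P k <-> (k <= n)%nat) ->
  (sum_C c 1 n * z)%C = sum_C (fun k => (c k * if dec k then z else RtoC 0)%C) 1 N.
Proof.
  intros Hn HP. rewrite (sum_C_extend _ n N Hn).
  - rewrite <- sum_C_mult_r. apply sum_C_ext. intros k Hk.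
    destruct (dec k) as [_ | H]; trivial. exfalso; apply H, HP; lia.
  - intros k Hk. destruct (dec k) as [H | _].
    + apply HP in H; lia.
    + apply Cmult_0_r.
Qed.

(** The coefficient [c k] is present exactly when [u >= k], so it contributes [c k] times the
    integral of the weight over [[k, y]]. *)
Lemma is_RInt_step (c : nat -> C) (g : R -> C) (J : nat -> C) (y : R) : 1 <= y ->
  (forall k, (1 <= k)%nat -> INR k <= y -> is_RInt_C g (INR k) y (J k)) ->
  is_RInt_C (fun u => (sum_C c 1 (floor_nat u) * g u)%C) 1 y
    (sum_C (fun k => (c k * J k)%C) 1 (floor_nat y)).
Proof.
  intros Hy H.
  apply (is_RInt_ext (V := C_R_NormedModule)) with
    (fun u => sum_C (fun k => (c k * if Rle_dec (INR k) u then g u else RtoC 0)%C) 1 (floor_nat y)).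
  - rewrite Rmin_left, Rmax_right by lra. intros u Hu. symmetry.
    apply sum_C_indicator with (P := fun k => INR k <= u).
    + apply le_floor_nat; [lra |].
      apply Rle_trans with u; [apply floor_nat_bounds; lra | lra].
    + intros k _. symmetry. apply le_floor_nat. lra.
  - apply is_RInt_sum_C. intros k Hk.
    assert (INR k <= y) by (apply le_floor_nat; lra || lia).
    apply is_RInt_Cmult_l, is_RInt_indicator_ge.
    + split; trivial. apply INR_ge_1. lia.
    + apply H; trivial; lia.
Qed.

(** The coefficient [c k] is present exactly when [t <= x / k], so it contributes [c k] times the
    integral of the weight over [[1, x / k]]. *)
Lemma is_RInt_step_inv (c : nat -> C) (g : R -> C) (J : nat -> C) (x : R) : 1 <= x ->
  (forall k, (1 <= k)%nat -> INR k <= x -> is_RInt_C g 1 (x / INR k) (J k)) ->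
  is_RInt_C (fun t => (sum_C c 1 (floor_nat (x / t)) * g t)%C) 1 x
    (sum_C (fun k => (c k * J k)%C) 1 (floor_nat x)).
Proof.
  intros Hx H.
  apply (is_RInt_ext (V := C_R_NormedModule)) with
    (fun t => sum_C (fun k => (c k * if Rle_dec t (x / INR k) then g t else RtoC 0)%C) 1 (floor_nat x)).
  - rewrite Rmin_left, Rmax_right by lra. intros t Ht. symmetry.
    assert (Hxt : 0 <= x / t) by (apply Rlt_le, Rdiv_lt_0_compat; lra).
    apply sum_C_indicator with (P := fun k => t <= x / INR k).
    + apply le_floor_nat; [lra |].
      apply Rle_trans with (x / t); [apply floor_nat_bounds; lra |].
      apply Rle_div_l; [lra |]. nra.
    + intros k Hk. rewrite le_floor_nat by lra.
      assert (1 <= INR k) by (apply INR_ge_1; lia).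
      rewrite <- !Rle_div_r by lra. rewrite Rmult_comm. easy.
  - apply is_RInt_sum_C. intros k Hk.
    assert (INR k <= x) by (apply le_floor_nat; lra || lia).
    assert (1 <= INR k) by (apply INR_ge_1; lia).
    apply is_RInt_Cmult_l, is_RInt_indicator_le.
    + split; [apply Rle_div_r | apply Rle_div_l]; nra.
    + apply H; trivial; lia.
Qed.

(** * Moebius inversion *)

Module MoebiusArith.
Import ssreflect ssrbool eqtype ssrnat seq div prime.

Lemma dvdn_divide (d m : nat) : dvdn d m <-> Nat.divide d m.
Proof.
split.
- by move/dvdnP => [k ->]; exists k.
- by move=> [k ->]; apply: dvdn_mull.
Qed.

Lemma primes_mul_prime (p e : nat) : prime p -> (0 < e)%N -> ~~ dvdn p e ->
  perm_eq (primes (p * e)) (p :: primes e).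
Proof.
move=> p_pr e_gt0 p_e.
apply: uniq_perm; first exact: primes_uniq.
  by rewrite /= primes_uniq mem_primes p_pr e_gt0 (negbTE p_e).
by move=> q; rewrite (primesM _ (prime_gt0 p_pr) e_gt0) primes_prime // !inE.
Qed.

Lemma forallb_all (T : Type) (a : pred T) (l : seq T) : forallb a l = all a l.
Proof. by elim: l => //= x l ->. Qed.

(** A prime not dividing [e] is one more entry in the list of primes, of valuation one, and
    it leaves the valuations at the other primes unchanged. *)
Lemma moebius_mul_prime_coprime (p e : nat) : prime p -> (0 < e)%N -> ~~ dvdn p e ->
  moebius (p * e) = - moebius e.
Proof.
move=> p_pr e_gt0 p_e; have pe := primes_mul_prime p e p_pr e_gt0 p_e.
have sz : length (primes (p * e)) = (length (primes e)).+1 by exact: (perm_size pe).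
rewrite /moebius !forallb_all (perm_all _ pe) sz /=.
have lp : logn p (p * e) = 1%N.
  by rewrite (lognM _ (prime_gt0 p_pr) e_gt0) logn_prime // eqxx lognE p_pr e_gt0 (negbTE p_e).
rewrite lp /=.
have -> : all (fun q => Nat.eqb (logn q (p * e)) 1) (primes e)
        = all (fun q => Nat.eqb (logn q e) 1) (primes e).
  apply: eq_in_all => q; rewrite mem_primes; case/and3P=> _ _ q_e.
  rewrite (lognM _ (prime_gt0 p_pr) e_gt0) logn_prime //.
  by have -> : (q == p) = false by apply: contraNF p_e => /eqP <-.
by case: (all _ _); rewrite /=; lra.
Qed.

Lemma moebius_mul_prime_dvd (p e : nat) : prime p -> (0 < e)%N -> dvdn p e ->
  moebius (p * e) = 0.
Proof.
move=> p_pr e_gt0 p_e; rewrite /moebius forallb_all.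
have p_in : p \in primes (p * e).
  by rewrite (primesM _ (prime_gt0 p_pr) e_gt0) primes_prime // mem_seq1 eqxx.
case: allP => // /(_ p p_in).
by rewrite (lognM _ (prime_gt0 p_pr) e_gt0) logn_prime // eqxx lognE p_pr e_gt0 p_e.
Qed.

Lemma moebius_1 : moebius 1 = 1.
Proof. by []. Qed.

Lemma exists_prime_dvdn (n : nat) : (1 < n)%N -> exists p, prime p /\ dvdn p n.
Proof. by move=> n_gt1; exists (pdiv n); rewrite pdiv_prime // pdiv_dvd. Qed.

Lemma dvdn_mul_prime (p k j : nat) : prime p -> ~~ dvdn p k -> dvdn p j ->
  dvdn (p * k) j = dvdn k j.
Proof.
by move=> p_pr p_k p_j; rewrite Gauss_dvd ?p_j // prime_coprime.
Qed.

Lemma prime_ge_2 (p : nat) : prime p -> (2 <= p)%coq_nat.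
Proof. by move=> /prime_gt1 /leP. Qed.

End MoebiusArith.

Lemma div_S (d n : nat) : (1 <= d)%nat ->
  (S n / d)%nat = if div.dvdn d (S n) then S (n / d) else (n / d)%nat.
Proof.
  intros Hd. generalize (Nat.div_mod_eq n d) (Nat.mod_upper_bound n d ltac:(lia)); intros E1 E2.
  destruct (div.dvdn d (S n)) eqn:E.
  - apply MoebiusArith.dvdn_divide in E. destruct E as [q Hq].
    rewrite Hq, Nat.div_mul by lia.
    assert (n / d < q)%nat by (apply (Nat.mul_lt_mono_pos_l d); lia).
    assert (q < S (S (n / d)))%nat by (apply (Nat.mul_lt_mono_pos_l d); lia).
    lia.
  - assert (Hr : (n mod d <> d - 1)%nat).
    { intros Hr. assert (H : is_true (div.dvdn d (S n))); [| rewrite H in E; discriminate].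
      apply MoebiusArith.dvdn_divide. exists (S (n / d))%nat. nia. }
    symmetry. apply Nat.div_unique with (S (n mod d)); nia.
Qed.

(** The multiples [j = d k] of [d] up to [n] are counted by [k <= n / d]. *)
Lemma sum_multiples (f : nat -> C) (d n : nat) : (1 <= d)%nat ->
  sum_C (fun j => if div.dvdn d j then f j else RtoC 0) 1 n
  = sum_C (fun k => f (d * k)%nat) 1 (n / d).
Proof.
  intros Hd. induction n.
  - rewrite Nat.div_small by lia. now rewrite !sum_C_0.
  - rewrite sum_C_S, IHn, div_S by easy.
    destruct (div.dvdn d (S n)) eqn:E.
    + rewrite sum_C_S. do 2 f_equal.
      apply MoebiusArith.dvdn_divide in E. destruct E as [q Hq].
      destruct q as [| q]; [lia |].
      replace (n / d)%nat with q; [lia |].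
      apply Nat.div_unique with (d - 1)%nat; lia.
    + C_eq. ring.
Qed.

(** For [j > 1] fix a prime [p] dividing [j].  The divisors of [j] prime to [p] cancel
    against their products with [p], and a multiple of [p ^ 2] contributes nothing. *)
Lemma sum_moebius_divisors (j n : nat) : (1 <= j <= n)%nat ->
  sum_C (fun k => if div.dvdn k j then RtoC (moebius k) else RtoC 0) 1 n
  = RtoC (if Nat.eqb j 1 then 1 else 0).
Proof.
  intros Hj. destruct (Nat.eqb_spec j 1) as [-> | Hj1].
  - rewrite (sum_C_extend _ 1 n).
    + rewrite sum_C_S, sum_C_0. simpl. rewrite MoebiusArith.moebius_1. C_eq. ring.
    + lia.
    + intros k Hk. destruct (div.dvdn k 1) eqn:E; trivial.
      apply MoebiusArith.dvdn_divide in E. apply Nat.divide_1_r in E. lia.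
  - destruct (MoebiusArith.exists_prime_dvdn j) as [p [Hp Hpj]].
    { apply (ssrbool.introT ssrnat.ltP). lia. }
    (* [h] is the summand, [a] its restriction to the integers prime to [p]; the terms of [h] at
       the multiples of [p] are the opposites of those of [a]. *)
    pose (h := (fun k => if div.dvdn k j then RtoC (moebius k) else RtoC 0) : nat -> C).
    pose (a := (fun k => if div.dvdn p k then RtoC 0 else h k) : nat -> C).
    assert (Hp2 := MoebiusArith.prime_ge_2 p Hp).
    assert (Hh : forall k, (1 <= k)%nat -> h (p * k)%nat = (- (1) * a k)%C).
    { intros k Hk. unfold a, h.
      assert (Hk0 : is_true (ssrnat.leq 1 k)) by (apply (ssrbool.introT ssrnat.leP); lia).
      change (p * k)%nat with (ssrnat.muln p k).
      destruct (div.dvdn p k) eqn:E.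
      - rewrite (MoebiusArith.moebius_mul_prime_dvd p k Hp Hk0 E).
        destruct (div.dvdn (ssrnat.muln p k) j); C_eq; ring.
      - assert (E' : is_true (negb (div.dvdn p k))) by now rewrite E.
        rewrite (MoebiusArith.dvdn_mul_prime p k j Hp E' Hpj).
        rewrite (MoebiusArith.moebius_mul_prime_coprime p k Hp Hk0 E').
        destruct (div.dvdn k j); [rewrite RtoC_opp |]; C_eq; ring. }
    transitivity (sum_C (fun k => (a k + if div.dvdn p k then h k else RtoC 0)%C) 1 n).
    { apply sum_C_ext. intros k _. change (h k = (a k + (if div.dvdn p k then h k else RtoC 0))%C).
      unfold a. destruct (div.dvdn p k); ring. }
    rewrite sum_C_plus, sum_multiples by lia.
    rewrite (sum_C_extend a (n / p) n).
    + rewrite (sum_C_ext (fun k => h (p * k)%nat) (fun k => (- (1) * a k)%C)).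
      * rewrite sum_C_mult_l. C_eq. ring.
      * intros; apply Hh; lia.
    (* Divisors of [j] prime to [p] are at most [j / p], so both ranges give the same sum. *)
    + apply Nat.Div0.div_le_upper_bound; nia.
    + intros k Hk. unfold a, h. destruct (div.dvdn p k) eqn:E; trivial.
      destruct (div.dvdn k j) eqn:E2; trivial. exfalso.
      assert (E' : is_true (negb (div.dvdn p k))) by now rewrite E.
      assert (H : is_true (div.dvdn (ssrnat.muln p k) j)).
      { rewrite (MoebiusArith.dvdn_mul_prime p k j Hp E' Hpj). exact E2. }
      apply MoebiusArith.dvdn_divide in H. change (ssrnat.muln p k) with (p * k)%nat in H.
      apply Nat.divide_pos_le in H; [| lia].
      assert (k <= n / p)%nat; [| lia].
      apply Nat.div_le_lower_bound; lia.
Qed.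

(** Collecting the terms with [i k = j] leaves, for each [j], the sum of [mu] over the divisors
    of [j], which vanishes unless [j = 1]. *)
Lemma sum_moebius_convolution (f : nat -> C) (n : nat) : (1 <= n)%nat ->
  sum_C (fun i => (RtoC (moebius i) * sum_C (fun k => f (i * k)%nat) 1 (n / i))%C) 1 n = f 1%nat.
Proof.
  intros Hn.
  transitivity (sum_C (fun i => sum_C (fun j =>
    (if div.dvdn i j then RtoC (moebius i) else RtoC 0) * f j)%C 1 n) 1 n).
  - apply sum_C_ext. intros i Hi. rewrite <- sum_multiples by lia. rewrite <- sum_C_mult_l.
    apply sum_C_ext. intros j _. destruct (div.dvdn i j); C_eq; ring.
  - rewrite sum_C_switch.
    transitivity (sum_C (fun j => (RtoC (if Nat.eqb j 1 then 1 else 0) * f j)%C) 1 n).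
    + apply sum_C_ext. intros j Hj. rewrite sum_C_mult_r, sum_moebius_divisors by lia. easy.
    + rewrite (sum_C_extend _ 1 n).
      * rewrite sum_C_S, sum_C_0. simpl. C_eq. ring.
      * lia.
      * intros k Hk. destruct (Nat.eqb_spec k 1); [lia |]. C_eq. ring.
Qed.

Lemma sum_moebius_floor (f : nat -> C) (x : R) : 1 <= x ->
  sum_C (fun i => (RtoC (moebius i)
    * sum_C (fun k => f (i * k)%nat) 1 (floor_nat (x / INR i)))%C) 1 (floor_nat x) = f 1%nat.
Proof.
  intros Hx. rewrite <- (sum_moebius_convolution f (floor_nat x)).
  - apply sum_C_ext. intros i Hi. rewrite floor_nat_div by (lra || lia). easy.
  - apply le_floor_nat; simpl; lra.
Qed.

(** * The identity for the partial sums of the Moebius function *)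

(** Between integers [rem zeta s t / t ^ 2] is a combination of [t ^ (s - 2)], [1 / t] and
    [1 / t ^ 2]; its two discontinuous parts, the sum over [k <= t] and the integer part inside
    the fractional part, are step functions against such weights. *)
Lemma is_RInt_rem (zeta : C -> C) (s : C) (y : R) : 1 <= y ->
  is_RInt_C (fun t => (rem zeta s t / RtoC (t ^ 2))%C) 1 y
    (zeta s * (cpow y (s - 1) - cpow 1 (s - 1))
     - sum_C (fun k => / cpow (INR k) s * (cpow y (s - 1) - cpow (INR k) (s - 1))) 1 (floor_nat y)
     - s * RtoC (ln y - ln 1)
     + (s - 1) * sum_C (fun k => 1 * RtoC (/ INR k - / y)) 1 (floor_nat y)
     + (s - 1) / 2 * RtoC (/ 1 - / y))%C.
Proof.
  intros Hy.
  apply is_RInt_C_ext with (fun t =>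
    (zeta s * ((s - 1) * cpow t (s - 1 - 1))
     - sum_C (fun k => / cpow (INR k) s) 1 (floor_nat t) * ((s - 1) * cpow t (s - 1 - 1))
     - s * RtoC (/ t)
     + (s - 1) * (sum_C (fun _ => RtoC 1) 1 (floor_nat t) * RtoC (/ t ^ 2))
     + (s - 1) / 2 * RtoC (/ t ^ 2))%C); [easy | |].
  - intros t Ht. unfold rem, sum_le. fold (floor_nat t).
    rewrite (sum_C_ext (fun k => cpow (t / INR k) s) (fun k => (cpow t s * / cpow (INR k) s)%C)).
    + rewrite sum_C_mult_l, frac_part_floor_nat, RtoC_minus, RtoC_floor_nat by lra.
      generalize (sum_C (fun k => / cpow (INR k) s)%C 1 (floor_nat t)).
      generalize (sum_C (fun _ => RtoC 1) 1 (floor_nat t)). intros A B.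
      change C in (type of A). change C in (type of B).
      rewrite (cpow_S t s), (cpow_S t (s - 1)) by lra.
      assert (Ht0 : RtoC t <> 0) by (apply RtoC_neq_0; lra).
      rewrite (RtoC_inv (t ^ 2)), (RtoC_inv t), RtoC_pow by nra.
      C_eq. field. exact Ht0.
    + intros k Hk. apply cpow_div_l; [lra |]. assert (1 <= INR k) by (apply INR_ge_1; lia). lra.
  - apply is_RInt_C_plus; [apply is_RInt_C_plus; [apply is_RInt_C_minus; [apply is_RInt_C_minus |] |] |].
    + apply is_RInt_Cmult_l, is_RInt_cpow; lra.
    + apply is_RInt_step; trivial. intros k Hk1 Hk2. apply INR_ge_1 in Hk1. apply is_RInt_cpow; lra.
    + apply is_RInt_Cmult_l, is_RInt_RtoC, is_RInt_inv; lra.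
    + apply is_RInt_Cmult_l, is_RInt_step; trivial.
      intros k Hk1 Hk2. apply INR_ge_1 in Hk1. apply is_RInt_RtoC, is_RInt_inv_sqr; lra.
    + apply is_RInt_Cmult_l, is_RInt_RtoC, is_RInt_inv_sqr; lra.
Qed.

Lemma m_eq (x : R) : RtoC (m x) = sum_C (fun n => RtoC (moebius n / INR n)) 1 (floor_nat x).
Proof. apply RtoC_sum. Qed.

Lemma m_check_eq (x : R) : RtoC (m_check x) =
  sum_C (fun n => (RtoC (moebius n / INR n) * RtoC (ln (x / INR n)))%C) 1 (floor_nat x).
Proof.
  unfold m_check, sum_le. rewrite RtoC_sum. apply sum_C_ext. intros; apply RtoC_mult.
Qed.

(** The term [mu n / n] of [m u] is present for [n <= u <= x], hence it is integrated over an
    interval of length [x - n]. *)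
Lemma m1_eq (x : R) : 1 <= x ->
  RtoC (m1 x) = sum_C (fun n => (RtoC (moebius n / INR n) * (1 - RtoC (INR n / x)))%C) 1 (floor_nat x).
Proof.
  intros Hx.
  assert (H : is_RInt_C (fun u => RtoC (m u)) 1 x
    (sum_C (fun n => RtoC (moebius n / INR n) * RtoC (x - INR n))%C 1 (floor_nat x))).
  { apply is_RInt_C_ext with (fun u =>
      (sum_C (fun n => RtoC (moebius n / INR n)) 1 (floor_nat u) * RtoC 1)%C); trivial.
    - intros t _. rewrite m_eq. apply Cmult_1_r.
    - apply is_RInt_step; trivial. intros k _ _. apply is_RInt_RtoC.
      generalize (is_RInt_const (V := R_NormedModule) (INR k) x 1).
      unfold scal; simpl; unfold mult; simpl. now rewrite Rmult_1_r. }
  (* The integral is real, so its value can be read off from the complex one. *)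
  assert (E : RtoC (RInt m 1 x) =
    sum_C (fun n => RtoC (moebius n / INR n) * RtoC (x - INR n))%C 1 (floor_nat x)).
  { assert (E : sum_C (fun n => RtoC (moebius n / INR n) * RtoC (x - INR n))%C 1 (floor_nat x)
      = RtoC (sum_n_m (G := R_AbelianMonoid) (fun n => moebius n / INR n * (x - INR n)) 1 (floor_nat x))).
    { rewrite RtoC_sum. apply sum_C_ext. intros; symmetry; apply RtoC_mult. }
    rewrite E in *. f_equal. apply (is_RInt_unique (V := R_CompleteNormedModule)).
    apply is_RInt_Re in H. exact H. }
  unfold m1. rewrite RtoC_mult, E, <- sum_C_mult_l. apply sum_C_ext. intros k Hk.
  assert (1 <= INR k) by (apply INR_ge_1; lia).
  rewrite <- !RtoC_mult, <- RtoC_minus, <- RtoC_mult. f_equal. field. lra.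
Qed.

(** The inner sums over [k <= x / n] in [is_RInt_rem] depend on [n k] only, so Moebius
    inversion replaces each of them by its term at [n k = 1]. *)
Lemma is_RInt_m_rem (zeta : C -> C) (s : C) (x : R) : 1 <= x ->
  is_RInt_C (fun t => (RtoC (m (x / t)) * rem zeta s t / RtoC (t ^ 2))%C) 1 x
    (zeta s * (cpow x (s - 1) * mu_sum s x - RtoC (m x))
     - (cpow x (s - 1) - 1)
     - s * RtoC (m_check x)
     + (s - 1) * (1 - RtoC (/ x))
     + (s - 1) / 2 * RtoC (m1 x))%C.
Proof.
  intros Hx.
  set (V := fun y : R => (zeta s * (cpow y (s - 1) - cpow 1 (s - 1))
     - sum_C (fun k => / cpow (INR k) s * (cpow y (s - 1) - cpow (INR k) (s - 1))) 1 (floor_nat y)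
     - s * RtoC (ln y - ln 1)
     + (s - 1) * sum_C (fun k => 1 * RtoC (/ INR k - / y)) 1 (floor_nat y)
     + (s - 1) / 2 * RtoC (/ 1 - / y))%C).
  match goal with |- is_RInt _ _ _ ?L => replace L with
    (sum_C (fun n => RtoC (moebius n / INR n) * V (x / INR n)%R)%C 1 (floor_nat x)) end.
  { apply is_RInt_C_ext with (fun t => (sum_C (fun n => RtoC (moebius n / INR n)) 1 (floor_nat (x / t))
      * (rem zeta s t / RtoC (t ^ 2)))%C); [easy | |].
    - intros t _. rewrite m_eq. unfold Cdiv. apply Cmult_assoc.
    - apply is_RInt_step_inv; trivial. intros k Hk1 Hk2. apply is_RInt_rem.
      apply INR_ge_1 in Hk1. apply Rle_div_r; lra. }
  (* The two kinds of summands over [k <= x / n], as functions of [n k]. *)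
  set (F := fun j : nat => (cpow x (s - 1) / cpow (INR j) s - RtoC (/ INR j))%C).
  set (G := fun j : nat => RtoC (/ INR j - / x)).
  transitivity (sum_C (fun n =>
    (zeta s * (cpow x (s - 1) * (RtoC (moebius n) / cpow (INR n) s) - RtoC (moebius n / INR n))
    - RtoC (moebius n) * sum_C (fun k => F (n * k)%nat) 1 (floor_nat (x / INR n))
    - s * (RtoC (moebius n / INR n) * RtoC (ln (x / INR n)))
    + (s - 1) * (RtoC (moebius n) * sum_C (fun k => G (n * k)%nat) 1 (floor_nat (x / INR n)))
    + (s - 1) / 2 * (RtoC (moebius n / INR n) * (1 - RtoC (INR n / x))))%C) 1 (floor_nat x)).
  - apply sum_C_ext. intros n Hn. unfold V.
    assert (Hn1 : 1 <= INR n) by (apply INR_ge_1; lia).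
    assert (Hn0 : RtoC (INR n) <> 0) by (apply RtoC_neq_0; lra).
    rewrite cpow_1_l, ln_1, Rinv_1, Rminus_0_r.
    rewrite (sum_C_ext _ (fun k => RtoC (INR n) * F (n * k)%nat)%C).
    + rewrite (sum_C_ext (fun k => 1 * RtoC (/ INR k - / (x / INR n)))%C
        (fun k => RtoC (INR n) * G (n * k)%nat)%C).
      * rewrite !sum_C_mult_l.
        generalize (sum_C (fun k => F (n * k)%nat) 1 (floor_nat (x / INR n))).
        generalize (sum_C (fun k => G (n * k)%nat) 1 (floor_nat (x / INR n))). intros A B.
        change C in (type of A). change C in (type of B).
        rewrite cpow_div_l, (cpow_S (INR n) s) by lra.
        replace (1 - / (x / INR n)) with (1 - INR n / x) by (field; lra).
        rewrite RtoC_minus, (RtoC_div (moebius n)) by lra.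
        C_eq. field. split; trivial. apply cpow_neq_0.
      * intros k Hk. unfold G. assert (1 <= INR k) by (apply INR_ge_1; lia).
        rewrite <- !RtoC_mult, mult_INR. f_equal. field. lra.
    + intros k Hk. unfold F. assert (Hk1 : 1 <= INR k) by (apply INR_ge_1; lia).
      assert (Hk0 : RtoC (INR k) <> 0) by (apply RtoC_neq_0; lra).
      rewrite mult_INR, cpow_mult_l, cpow_div_l, (cpow_S (INR n) s), (cpow_S (INR k) s) by lra.
      rewrite RtoC_inv, RtoC_mult by nra.
      C_eq. field. repeat split; trivial; apply cpow_neq_0.
  - rewrite !sum_C_plus, !sum_C_minus, !sum_C_mult_l, !sum_C_minus, !sum_C_mult_l.
    rewrite (sum_moebius_floor F), (sum_moebius_floor G) by easy.
    rewrite <- m_eq, <- m_check_eq, <- m1_eq by easy.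
    unfold mu_sum, sum_le, F, G. fold (floor_nat x).
    rewrite RtoC_minus, cpow_1_l. simpl INR. rewrite Rinv_1.
    C_eq. field.
Qed.

Lemma zeta_mu_sum_identity (zeta : C -> C) (s : C) (x : R) : 1 <= x ->
  (zeta s * (mu_sum s x - RtoC (m x) / cpow x (s - 1)) - 1
   = s * (RtoC (m_check x) - 1) / cpow x (s - 1)
     - (s - 1) * RtoC (m1 x) / (2 * cpow x (s - 1))
     + (s - 1) / cpow x s
     + / cpow x (s - 1)
       * RInt (V := C_R_CompleteNormedModule)
           (fun t : R => RtoC (m (x / t)) * rem zeta s t / RtoC (t ^ 2)) 1 x)%C.
Proof.
  intros Hx.
  rewrite (is_RInt_unique (V := C_R_CompleteNormedModule) _ _ _ _ (is_RInt_m_rem zeta s x Hx)).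
  rewrite (cpow_S x s), RtoC_inv by lra.
  assert (Hx0 : RtoC x <> 0) by (apply RtoC_neq_0; lra).
  generalize (cpow_neq_0 x (s - 1)). intros Hc. C_eq. field. auto.
Qed.

(** * Convergence in the complex plane and improper integrals *)

(** Equivalent to convergence for the filter of neighbourhoods ([filterlim_cvg_C]), but the
    limit laws reduce to those for nonnegative real sequences. *)
Definition cvg_C (u : nat -> C) (l : C) : Prop := is_lim_seq (fun n => Cmod (u n - l)) 0.

Lemma filterlim_cvg_C (u : nat -> C) (l : C) :
  filterlim u eventually (locally (T := C_UniformSpace) l) <-> cvg_C u l.
Proof.
  split; intros H.
  - apply is_lim_seq_spec. intros eps.
    assert (Hs : 0 < eps / sqrt 2).
    { apply Rdiv_lt_0_compat; [apply cond_pos | apply Rlt_sqrt2_0]. }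
    destruct (proj1 (filterlim_locally (U := C_UniformSpace) u l) H (mkposreal _ Hs)) as [N HN].
    exists N. intros n Hn. specialize (HN n Hn).
    apply C_NormedModule_mixin_compat2 in HN. simpl pos in HN.
    rewrite Rminus_0_r, Rabs_pos_eq by apply Cmod_ge_0.
    replace (sqrt 2 * (eps / sqrt 2)) with (pos eps) in HN; [exact HN |].
    field. apply Rgt_not_eq, Rlt_sqrt2_0.
  - apply (filterlim_locally (U := C_UniformSpace)). intros eps.
    destruct (proj2 (is_lim_seq_spec _ _) H eps) as [N HN].
    exists N. intros n Hn. specialize (HN n Hn).
    rewrite Rminus_0_r, Rabs_pos_eq in HN by apply Cmod_ge_0.
    now apply C_NormedModule_mixin_compat1.
Qed.

Lemma cvg_C_squeeze (u : nat -> C) (l : C) (v : nat -> R) :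
  eventually (fun n => Cmod (u n - l) <= v n) -> is_lim_seq v 0 -> cvg_C u l.
Proof.
  intros H Hv. apply is_lim_seq_le_le_loc with (fun _ => 0) v; trivial.
  - destruct H as [N HN]. exists N. intros n Hn. split; [apply Cmod_ge_0 | auto].
  - apply is_lim_seq_const.
Qed.

Lemma cvg_C_ext_loc (u v : nat -> C) (l : C) :
  eventually (fun n => u n = v n) -> cvg_C u l -> cvg_C v l.
Proof.
  intros H. apply is_lim_seq_ext_loc. destruct H as [N HN]. exists N. intros n Hn. now rewrite HN.
Qed.

Lemma cvg_C_const (l : C) : cvg_C (fun _ => l) l.
Proof.
  apply is_lim_seq_ext with (fun _ => 0); [| apply is_lim_seq_const].
  intros _. replace (l - l)%C with (RtoC 0) by ring. now rewrite Cmod_0.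
Qed.

Lemma cvg_C_plus (u v : nat -> C) (l k : C) :
  cvg_C u l -> cvg_C v k -> cvg_C (fun n => (u n + v n)%C) (l + k)%C.
Proof.
  intros Hu Hv. apply cvg_C_squeeze with (fun n => Cmod (u n - l) + Cmod (v n - k)).
  - exists 0%nat. intros n _.
    replace (u n + v n - (l + k))%C with ((u n - l) + (v n - k))%C by ring. apply Cmod_triangle.
  - replace (Finite 0) with (Finite (0 + 0)) by (f_equal; ring).
    now apply is_lim_seq_plus'.
Qed.

Lemma cvg_C_mult_l (c : C) (u : nat -> C) (l : C) :
  cvg_C u l -> cvg_C (fun n => (c * u n)%C) (c * l)%C.
Proof.
  intros Hu. apply cvg_C_squeeze with (fun n => Cmod c * Cmod (u n - l)).
  - exists 0%nat. intros n _. rewrite <- Cmod_mult. right. f_equal. ring.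
  - replace (Finite 0) with (Rbar_mult (Cmod c) 0) by (simpl; f_equal; ring).
    now apply is_lim_seq_scal_l.
Qed.

Lemma cvg_C_minus (u v : nat -> C) (l k : C) :
  cvg_C u l -> cvg_C v k -> cvg_C (fun n => (u n - v n)%C) (l - k)%C.
Proof.
  intros Hu Hv. apply (cvg_C_mult_l (- (1))) in Hv.
  replace (l - k)%C with (l + - (1) * k)%C by ring.
  apply cvg_C_ext_loc with (2 := cvg_C_plus _ _ _ _ Hu Hv).
  exists 0%nat. intros; ring.
Qed.

Lemma Cmod_cvg_le (u : nat -> C) (l z : C) (B : R) :
  cvg_C u l -> eventually (fun n => Cmod (u n - z) <= B) -> Cmod (l - z) <= B.
Proof.
  intros Hu HB.
  assert (H : Rbar_le (Cmod (l - z)) (B + 0)).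
  { apply is_lim_seq_le_loc with (fun _ => Cmod (l - z)) (fun n => B + Cmod (u n - l)).
    - destruct HB as [N HN]. exists N. intros n Hn.
      replace (l - z)%C with ((u n - z) + - (u n - l))%C by ring.
      apply Rle_trans with (1 := Cmod_triangle _ _). rewrite Cmod_opp.
      specialize (HN n Hn). lra.
    - apply is_lim_seq_const.
    - apply is_lim_seq_plus'; trivial. apply is_lim_seq_const. }
  simpl in H. lra.
Qed.

Lemma cvg_C_unique (u : nat -> C) (l k : C) : cvg_C u l -> cvg_C u k -> l = k.
Proof.
  intros H1 H2. generalize (cvg_C_minus _ _ _ _ H1 H2); intros H.
  assert (E : Cmod (l - k) <= 0).
  { replace (l - k)%C with ((l - k) - 0)%C by ring. apply Cmod_cvg_le with (1 := H).
    exists 0%nat. intros n _. replace (u n - u n - 0)%C with (RtoC 0) by ring. rewrite Cmod_0. lra. }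
  apply Ceq_minus, Cmod_eq_0. generalize (Cmod_ge_0 (l - k)). lra.
Qed.

Lemma cvg_C_cauchy (u : nat -> C) :
  (forall eps : posreal, exists N, forall n p, (N <= n)%nat -> (N <= p)%nat -> Cmod (u p - u n) < eps) ->
  exists l, cvg_C u l.
Proof.
  intros H.
  destruct (proj1 (filterlim_locally_cauchy (U := C_R_CompleteNormedModule) (F := eventually) u)) as [l Hl].
  - intros eps. destruct (H eps) as [N HN]. exists (fun n => (N <= n)%nat). split.
    + now exists N.
    + intros n p Hn Hp. apply C_NormedModule_mixin_compat1. now apply HN.
  - exists l. now apply filterlim_cvg_C.
Qed.

Lemma is_lim_seq_near (u v : nat -> R) (l : R) :
  (forall n, Rabs (u n - l) <= v n) -> is_lim_seq v 0 -> is_lim_seq u l.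
Proof.
  intros H Hv. apply is_lim_seq_le_le with (fun n => l - v n) (fun n => l + v n).
  - intros n. specialize (H n). apply Rabs_le_between in H. lra.
  - replace (Finite l) with (Finite (l - 0)) by (f_equal; ring).
    apply is_lim_seq_minus'; trivial. apply is_lim_seq_const.
  - replace (Finite l) with (Finite (l + 0)) by (f_equal; ring).
    apply is_lim_seq_plus'; trivial. apply is_lim_seq_const.
Qed.

Lemma is_lim_seq_Rpower_neg (e : R) : 0 < e -> is_lim_seq (fun n => Rpower (INR n) (- e)) 0.
Proof.
  intros He. unfold Rpower.
  apply (filterlim_comp _ _ _ (fun n => - e * ln (INR n)) exp _ (Rbar_locally m_infty)).
  - replace m_infty with (Rbar_mult (- e) p_infty).
    + apply is_lim_seq_scal_l.
      apply (filterlim_comp _ _ _ INR ln _ (Rbar_locally p_infty)).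
      * apply is_lim_seq_INR.
      * apply is_lim_ln_p.
    + apply is_Rbar_mult_unique. apply is_Rbar_mult_sym, is_Rbar_mult_p_infty_neg. simpl. lra.
  - apply is_lim_exp_m.
Qed.

Lemma eventually_INR_ge (y : R) : eventually (fun n => y <= INR n).
Proof.
  destruct (proj2 (is_lim_seq_spec _ _) is_lim_seq_INR y) as [N HN].
  exists N. intros n Hn. left. auto.
Qed.

(** The integral of [u ^ (- e - 1)] over [[a, infinity)] is [a ^ (- e) / e]. *)
Lemma Cmod_RInt_tail_le (g : R -> C) (K e a b : R) (l : C) :
  0 < e -> 0 <= K -> 1 <= a <= b -> (forall u, a <= u <= b -> Cmod (g u) <= K * Rpower u (- e - 1)) ->
  is_RInt_C g a b l -> Cmod l <= K / e * Rpower a (- e).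
Proof.
  intros He HK Hab Hg Hl.
  apply Rle_trans with (K * ((Rpower b (- e) - Rpower a (- e)) / - e)).
  - apply Cmod_RInt_le with (2 := Hg) (3 := Hl); [lra |].
    apply (is_RInt_scal (V := R_NormedModule)). apply is_RInt_Rpower; lra.
  - replace (K * ((Rpower b (- e) - Rpower a (- e)) / - e))
      with (K / e * (Rpower a (- e) - Rpower b (- e))) by (field; lra).
    apply Rmult_le_compat_l.
    + apply Rdiv_le_0_compat; lra.
    + generalize (Rpower_pos b (- e)). lra.
Qed.

Lemma ex_improper (g : R -> C) (K e : R) :
  0 < e -> 0 <= K -> (forall y, 1 <= y -> ex_RInt_C g 1 y) ->
  (forall u, 1 <= u -> Cmod (g u) <= K * Rpower u (- e - 1)) ->
  exists l, cvg_C (fun n => RInt_C g 1 (INR n)) l.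
Proof.
  intros He HK Hex Hg. apply cvg_C_cauchy. intros eps.
  assert (H0 : is_lim_seq (fun n => K / e * Rpower (INR n) (- e)) 0).
  { replace (Finite 0) with (Rbar_mult (K / e) 0) by (simpl; f_equal; ring).
    now apply is_lim_seq_scal_l, is_lim_seq_Rpower_neg. }
  destruct (proj2 (is_lim_seq_spec _ _) H0 eps) as [N HN].
  assert (key : forall n p, (max 1 N <= n <= p)%nat ->
    Cmod (RInt_C g 1 (INR p) - RInt_C g 1 (INR n)) < eps).
  { intros n p Hnp. assert (Hn : 1 <= INR n) by (apply INR_ge_1; lia).
    assert (Hp : INR n <= INR p) by (apply le_INR; lia).
    apply Rle_lt_trans with (K / e * Rpower (INR n) (- e)).
    - apply Cmod_RInt_tail_le with g (INR p); trivial; [lra | intros; apply Hg; lra |].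
      apply is_RInt_C_between with 1; apply RInt_C_correct, Hex; lra.
    - specialize (HN n ltac:(lia)). rewrite Rminus_0_r in HN.
      apply Rle_lt_trans with (2 := HN). apply Rle_abs. }
  exists (max 1 N). intros n p Hn Hp. destruct (Nat.le_ge_cases n p).
  - now apply key.
  - replace (RInt_C g 1 (INR p) - RInt_C g 1 (INR n))%C
      with (- (RInt_C g 1 (INR n) - RInt_C g 1 (INR p)))%C by ring.
    rewrite Cmod_opp. now apply key.
Qed.

(** The distance from the integral over [[1, t]] to its limit is the tail beyond [t].  The bound on
    the integrand is asked only beyond [t], which matters when it depends on [t]. *)
Lemma Cmod_improper_tail_le (g : R -> C) (K e t : R) (l I : C) :
  0 < e -> 0 <= K -> 1 <= t -> (forall y, 1 <= y -> ex_RInt_C g 1 y) ->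
  (forall u, t <= u -> Cmod (g u) <= K * Rpower u (- e - 1)) ->
  cvg_C (fun n => RInt_C g 1 (INR n)) l -> is_RInt_C g 1 t I ->
  Cmod (l - I) <= K / e * Rpower t (- e).
Proof.
  intros He HK Ht Hex Hg Hl HI. apply Cmod_cvg_le with (1 := Hl).
  destruct (eventually_INR_ge t) as [N HN]. exists N. intros n Hn. specialize (HN n Hn).
  apply Cmod_RInt_tail_le with g (INR n); trivial; [lra | intros; apply Hg; lra |].
  apply is_RInt_C_between with 1; trivial. apply RInt_C_correct, Hex; lra.
Qed.

(** Defined by limits of real sequences, hence total; meaningful when the improper integral
    converges along the integers ([improper_C_correct]). *)
Definition improper_C (g : R -> C) : C :=
  (real (Lim_seq (fun n => Re (RInt_C g 1 (INR n)))),
   real (Lim_seq (fun n => Im (RInt_C g 1 (INR n))))).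

Lemma improper_C_correct (g : R -> C) :
  (exists l, cvg_C (fun n => RInt_C g 1 (INR n)) l) ->
  cvg_C (fun n => RInt_C g 1 (INR n)) (improper_C g).
Proof.
  intros [l Hl]. replace (improper_C g) with l; trivial. symmetry.
  apply C_ext; unfold improper_C; simpl.
  - rewrite (is_lim_seq_unique _ (Re l)); trivial.
    apply is_lim_seq_near with (2 := Hl). intros n. apply (re_le_Cmod (RInt_C g 1 (INR n) - l)).
  - rewrite (is_lim_seq_unique _ (Im l)); trivial.
    apply is_lim_seq_near with (2 := Hl). intros n. apply (Im_le_Cmod (RInt_C g 1 (INR n) - l)).
Qed.

(** * Euler-Maclaurin summation up to a finite point *)

(** This is [B_2({u}) - 1 / 6], with [B_2] the second Bernoulli polynomial.  Dropping the constant
    makes it vanish at the integers and gives it the sign used for the values of zeta at reals. *)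
Definition B2per (u : R) : R := (u - INR (floor_nat u)) ^ 2 - (u - INR (floor_nat u)).

Lemma B2per_bounds (u : R) : 0 <= u -> - / 4 <= B2per u <= 0.
Proof.
  intros Hu. destruct (floor_nat_bounds u Hu). unfold B2per.
  set (d := u - INR (floor_nat u)).
  assert (0 <= d) by (unfold d; lra). assert (d <= 1) by (unfold d; lra). split.
  - generalize (pow2_ge_0 (d - / 2)). lra.
  - generalize (Rmult_le_pos d (1 - d)). lra.
Qed.

Lemma Cmod_B2per_le (u : R) : 0 <= u -> Cmod (RtoC (B2per u)) <= / 4.
Proof.
  intros Hu. rewrite Cmod_R. destruct (B2per_bounds u Hu). apply Rabs_le. lra.
Qed.

Lemma sum_C_2k (n : nat) :
  sum_C (fun k => RtoC (2 * INR k)) 1 n = RtoC (INR n * INR n + INR n).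
Proof.
  induction n.
  - rewrite sum_C_0. simpl. f_equal. ring.
  - rewrite sum_C_S, IHn, <- RtoC_plus, S_INR. f_equal. ring.
Qed.

(** Writing [n] for the integer part of [u], this expands
    [(u - n) ^ 2 - (u - n) = u ^ 2 - u - 2 u n + n ^ 2 + n] into step functions with smooth
    weights, where [n ^ 2 + n] is the sum of the even numbers up to [2 n]. *)
Lemma B2per_step (u : R) : RtoC (B2per u) =
  (RtoC (u * u - u) - sum_C (fun _ => RtoC 1) 1 (floor_nat u) * RtoC (2 * u)
   + sum_C (fun k => RtoC (2 * INR k)) 1 (floor_nat u))%C.
Proof.
  rewrite sum_C_2k, <- RtoC_floor_nat, <- RtoC_mult, <- RtoC_minus, <- RtoC_plus.
  unfold B2per. C_eq. f_equal. ring.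
Qed.

Lemma ex_RInt_B2per (g : R -> C) (y : R) : 1 <= y ->
  (forall u, 1 <= u -> continuous_C g u) -> ex_RInt_C (fun u => (RtoC (B2per u) * g u)%C) 1 y.
Proof.
  intros Hy Hg.
  assert (H1 : forall u, 1 <= u -> continuous_C (fun u => (RtoC u * g u)%C) u).
  { intros u Hu. apply continuous_Cmult; [| now apply Hg]. apply continuous_RtoC, continuous_id. }
  assert (H2 : forall u, 1 <= u -> continuous_C (fun u => (RtoC u * (RtoC u * g u))%C) u).
  { intros u Hu. apply continuous_Cmult; [| now apply H1]. apply continuous_RtoC, continuous_id. }
  assert (H3 : forall u, 1 <= u -> continuous_C (fun u => (2 * (RtoC u * g u))%C) u).
  { intros u Hu. apply continuous_Cmult; [apply continuous_const | now apply H1]. }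
  eexists.
  apply is_RInt_C_ext with (fun u => ((RtoC u * (RtoC u * g u) - RtoC u * g u)
    - sum_C (fun _ => RtoC 1) 1 (floor_nat u) * (2 * (RtoC u * g u))
    + sum_C (fun k => RtoC (2 * INR k)) 1 (floor_nat u) * g u)%C); trivial.
  - intros u _. rewrite B2per_step, RtoC_minus, !RtoC_mult. C_eq. ring.
  - apply is_RInt_C_plus; [apply is_RInt_C_minus; [apply is_RInt_C_minus |] |].
    + now apply RInt_C_correct, ex_RInt_C_continuous; try lra.
    + now apply RInt_C_correct, ex_RInt_C_continuous; try lra.
    + apply is_RInt_step with (J := fun k => RInt_C (fun u => (2 * (RtoC u * g u))%C) (INR k) y); trivial.
      intros k Hk1 Hk2. apply INR_ge_1 in Hk1.
      now apply RInt_C_correct, ex_RInt_C_continuous.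
    + apply is_RInt_step with (J := fun k => RInt_C g (INR k) y); trivial.
      intros k Hk1 Hk2. apply INR_ge_1 in Hk1.
      now apply RInt_C_correct, ex_RInt_C_continuous.
Qed.

(** The part of [rem zeta s y / y ^ s] that does not involve [zeta s]. *)
Definition EM_boundary (s : C) (y : R) : C :=
  (- (s - 1) * sum_C (fun k => cpow (INR k) (- s)) 1 (floor_nat y)
   - cpow y (1 - s) - (s - 1) * RtoC (y - INR (floor_nat y) - / 2) * cpow y (- s))%C.

Definition EM_integrand (s : C) (u : R) : C := (RtoC (B2per u) * cpow u (- s - 1 - 1))%C.

(** Second-order Euler-Maclaurin summation of [k ^ (- s)] up to [y], multiplied by
    [(s - 1) s (s + 1)] so that it holds without exception for all [s]. *)
Lemma is_RInt_B2per_cpow (s : C) (y : R) : 1 <= y ->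
  is_RInt_C (fun u => ((s - 1) * s * (s + 1) * (RtoC (B2per u) * cpow u (- s - 1 - 1)))%C) 1 y
    (2 * EM_boundary s y + (s + 1) - s * (s - 1) * RtoC (B2per y) * cpow y (- s - 1))%C.
Proof.
  intros Hy.
  assert (E1 : (2 * EM_boundary s y + (s + 1) - s * (s - 1) * RtoC (B2per y) * cpow y (- s - 1))%C =
    ((- s * (s + 1)) * (cpow y (1 - s) - cpow 1 (1 - s))
     + (s - 1) * (s + 1) * (cpow y (- s) - cpow 1 (- s))
     + sum_C (fun k => 1 * (2 * (s - 1) * (s + 1) * (cpow y (- s) - cpow (INR k) (- s)))) 1 (floor_nat y)
     + sum_C (fun k => RtoC (2 * INR k) * ((- (s - 1) * s) * (cpow y (- s - 1) - cpow (INR k) (- s - 1))))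
         1 (floor_nat y))%C).
  { rewrite (sum_C_ext (fun k => RtoC (2 * INR k) * _)%C
      (fun k => RtoC (2 * INR k) * ((- (s - 1) * s) * cpow y (- s - 1))
                + 2 * (s - 1) * s * cpow (INR k) (- s))%C).
    - rewrite (sum_C_ext (fun k => 1 * _)%C
      (fun k => 1 * (2 * (s - 1) * (s + 1) * cpow y (- s))
                - 2 * (s - 1) * (s + 1) * cpow (INR k) (- s))%C).
      + rewrite sum_C_minus, sum_C_plus, !sum_C_mult_l, !sum_C_mult_r.
        rewrite sum_C_2k, sum_C_const. unfold EM_boundary, B2per.
        rewrite !cpow_1_l.
        rewrite (cpow_S y (1 - s)), (cpow_S y (- s)) by lra.
        replace (1 - s - 1)%C with (- s)%C by ring.
        rewrite (cpow_S y (- s)) by lra.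
        generalize (sum_C (fun k => cpow (INR k) (- s)) 1 (floor_nat y)).
        intros A. change C in (type of A).
        replace (y - INR (floor_nat y) - / 2) with ((2 * y - 2 * INR (floor_nat y) - 1) / 2) by field.
        rewrite RtoC_div by lra.
        repeat (rewrite RtoC_minus || rewrite RtoC_plus || rewrite RtoC_mult || rewrite RtoC_pow).
        C_eq. field.
      + intros; C_eq; ring.
    - intros k Hk. assert (1 <= INR k) by (apply INR_ge_1; lia).
      rewrite (cpow_S (INR k) (- s)), RtoC_mult by lra. C_eq. ring. }
  rewrite E1.
  apply is_RInt_C_ext with (fun u =>
    ((- s * (s + 1)) * ((1 - s) * cpow u (1 - s - 1))
     + (s - 1) * (s + 1) * (- s * cpow u (- s - 1))
     + sum_C (fun _ => RtoC 1) 1 (floor_nat u) * (2 * (s - 1) * (s + 1) * (- s * cpow u (- s - 1)))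
     + sum_C (fun k => RtoC (2 * INR k)) 1 (floor_nat u) *
         ((- (s - 1) * s) * ((- s - 1) * cpow u (- s - 1 - 1))))%C); trivial.
  - intros u Hu. rewrite B2per_step.
    generalize (sum_C (fun k => RtoC (2 * INR k)) 1 (floor_nat u)).
    generalize (sum_C (fun _ => RtoC 1) 1 (floor_nat u)). intros A B.
    change C in (type of A). change C in (type of B).
    replace (1 - s - 1)%C with (- s)%C by ring.
    rewrite (cpow_S u (- s)), (cpow_S u (- s - 1)) by lra.
    rewrite RtoC_minus, !RtoC_mult. C_eq. ring.
  - apply is_RInt_C_plus; [apply is_RInt_C_plus; [apply is_RInt_C_plus |] |].
    + apply is_RInt_Cmult_l, is_RInt_cpow; lra.
    + apply is_RInt_Cmult_l, is_RInt_cpow; lra.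
    + apply is_RInt_step; trivial. intros k Hk _. apply INR_ge_1 in Hk.
      apply is_RInt_Cmult_l, is_RInt_cpow; lra.
    + apply is_RInt_step; trivial. intros k Hk _. apply INR_ge_1 in Hk.
      apply is_RInt_Cmult_l, is_RInt_cpow; lra.
Qed.

Lemma rem_EM_boundary (zeta : C -> C) (s : C) (t : R) : 1 <= t ->
  rem zeta s t = (cpow t s * ((s - 1) * zeta s + EM_boundary s t))%C.
Proof.
  intros Ht. unfold rem, sum_le, EM_boundary. fold (floor_nat t).
  rewrite (sum_C_ext (fun k => cpow (t / INR k) s) (fun k => (cpow t s * cpow (INR k) (- s))%C)).
  - rewrite sum_C_mult_l, frac_part_floor_nat by lra.
    assert (E1 : cpow t (1 - s) = (RtoC t / cpow t s)%C).
    { unfold Cminus. rewrite cpow_plus, cpow_opp, cpow_1 by lra. easy. }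
    rewrite E1, cpow_opp.
    generalize (sum_C (fun k => cpow (INR k) (- s)) 1 (floor_nat t)).
    intros A. change C in (type of A).
    rewrite !RtoC_minus, (RtoC_inv 2) by lra. C_eq. field. apply cpow_neq_0.
  - intros k Hk. assert (1 <= INR k) by (apply INR_ge_1; lia).
    rewrite cpow_div_l, cpow_opp by lra. easy.
Qed.

(** * The Euler-Maclaurin integral and zeta to the right of 1 *)

(** Called [F s] in the introduction. *)
Definition EM_integral (s : C) : C := improper_C (EM_integrand s).

Lemma Cmod_EM_integrand_le (s : C) (u : R) : 1 <= u ->
  Cmod (EM_integrand s u) <= / 4 * Rpower u (- (Re s + 1) - 1).
Proof.
  intros Hu. unfold EM_integrand. rewrite Cmod_mult, Cmod_cpow.
  replace (Re (- s - 1 - 1)) with (- (Re s + 1) - 1) by (unfold Re; simpl; ring).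
  apply Rmult_le_compat_r; [left; apply Rpower_pos | apply Cmod_B2per_le; lra].
Qed.

Lemma ex_RInt_EM_integrand (s : C) (y : R) : 1 <= y -> ex_RInt_C (EM_integrand s) 1 y.
Proof.
  intros Hy. apply ex_RInt_B2per; trivial. intros u Hu. apply continuous_cpow. lra.
Qed.

Lemma cvg_EM_integral (s : C) : -1 < Re s ->
  cvg_C (fun n => RInt_C (EM_integrand s) 1 (INR n)) (EM_integral s).
Proof.
  intros Hs. apply improper_C_correct, ex_improper with (/ 4) (Re s + 1); try lra.
  - apply ex_RInt_EM_integrand.
  - apply Cmod_EM_integrand_le.
Qed.

Lemma cvg_zeta_partial (zeta : C -> C) (s : C) : is_riemann_zeta zeta -> 1 < Re s ->
  cvg_C (fun n => sum_C (fun k => cpow (INR k) (- s)) 1 n) (zeta s).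
Proof.
  intros [_ Hz] Hs. specialize (Hz s Hs). apply filterlim_cvg_C in Hz.
  apply (is_lim_seq_incr_1 (fun n => Cmod (sum_C (fun k => cpow (INR k) (- s)) 1 n - zeta s))).
  apply is_lim_seq_ext with (2 := Hz). intros n. do 2 f_equal.
  apply (sum_n_m_S (G := C_AbelianMonoid) (fun k => cpow (INR k) (- s)) 0 n).
Qed.

Lemma cvg_cpow_neg (s : C) : Re s < 0 -> cvg_C (fun n => cpow (INR n) s) 0.
Proof.
  intros Hs. apply cvg_C_squeeze with (fun n => Rpower (INR n) (- (- Re s))).
  - exists 0%nat. intros n _. unfold Cminus. rewrite Copp_0, Cplus_0_r, Cmod_cpow, Ropp_involutive. lra.
  - apply is_lim_seq_Rpower_neg. lra.
Qed.

(** At an integer [y] the fractional part and [B2per y] vanish, and the powers [y ^ (1 - s)] and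
    [y ^ (- s)] in the boundary term tend to [0]. *)
Lemma zeta_EM_right (zeta : C -> C) (s : C) : is_riemann_zeta zeta -> 1 < Re s ->
  ((s - 1) * s * (s + 1) * EM_integral s = (s + 1) - 2 * ((s - 1) * zeta s))%C.
Proof.
  intros Hz Hs.
  assert (Hs1 : -1 < Re s) by lra.
  assert (L1 := cvg_C_mult_l ((s - 1) * s * (s + 1)) _ _ (cvg_EM_integral s Hs1)).
  assert (L2 : cvg_C (fun n => ((s + 1) - 2 * (s - 1) * sum_C (fun k => cpow (INR k) (- s)) 1 n
      - 2 * cpow (INR n) (1 - s) + (s - 1) * cpow (INR n) (- s))%C)
      ((s + 1) - 2 * (s - 1) * zeta s - 2 * 0 + (s - 1) * 0)%C).
  { apply cvg_C_plus; [apply cvg_C_minus; [apply cvg_C_minus |] |].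
    - apply cvg_C_const.
    - apply cvg_C_mult_l. now apply cvg_zeta_partial.
    - apply cvg_C_mult_l, cvg_cpow_neg. simpl. unfold Re in *. lra.
    - apply cvg_C_mult_l, cvg_cpow_neg. simpl. unfold Re in *. lra. }
  replace ((s + 1) - 2 * ((s - 1) * zeta s))%C with
    ((s + 1) - 2 * (s - 1) * zeta s - 2 * 0 + (s - 1) * 0)%C by ring.
  apply cvg_C_unique with (1 := L1). apply cvg_C_ext_loc with (2 := L2).
  destruct (eventually_INR_ge 1) as [M HM]. exists M. intros n Hn. specialize (HM n Hn).
  rewrite <- (is_RInt_C_unique _ _ _ _ (is_RInt_Cmult_l ((s - 1) * s * (s + 1)) _ _ _ _
    (RInt_C_correct _ _ _ (ex_RInt_EM_integrand s _ HM)))).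
  symmetry. apply is_RInt_C_unique.
  match goal with |- is_RInt _ _ _ ?L => replace L with
    (2 * EM_boundary s (INR n) + (s + 1) - s * (s - 1) * RtoC (B2per (INR n)) * cpow (INR n) (- s - 1))%C end.
  - now apply is_RInt_B2per_cpow.
  - unfold EM_boundary, B2per. rewrite floor_nat_INR.
    replace (INR n - INR n) with 0 by ring.
    replace (0 ^ 2 - 0) with 0 by ring. replace (0 - / 2) with (-1 / 2) by field.
    rewrite RtoC_div by lra. change (RtoC (-1)) with (RtoC (- (1))). rewrite RtoC_opp.
    generalize (sum_C (fun k => cpow (INR k) (- s)) 1 n). intros A. change C in (type of A).
    C_eq. field.
Qed.

(** * Complex power series *)

Fixpoint psum (f : nat -> C) (n : nat) : C :=
  match n with O => RtoC 0 | S k => (psum f k + f k)%C end.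

Lemma sum_n_psum (f : nat -> C) (n : nat) : sum_n (G := C_AbelianMonoid) f n = psum f (S n).
Proof.
  induction n.
  - rewrite sum_O. simpl. symmetry. apply Cplus_0_l.
  - rewrite sum_Sn, IHn. reflexivity.
Qed.

Lemma pow_n_Cpow (z : C) (n : nat) : pow_n (K := C_Ring) z n = (z ^ n)%C.
Proof. induction n; simpl; [reflexivity | now rewrite IHn]. Qed.

Lemma analytic_cvg (a : nat -> C) (z l : C) :
  is_pseries (K := C_AbsRing) (V := C_NormedModule) a z l <->
  cvg_C (fun n => psum (fun k => (z ^ k * a k)%C) (S n)) l.
Proof.
  unfold is_pseries, is_series. rewrite filterlim_cvg_C.
  assert (E : forall n, sum_n (G := C_NormedModule) (fun k => scal (pow_n (K := C_AbsRing) z k) (a k)) n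
    = psum (fun k => (z ^ k * a k)%C) (S n)).
  { intros n. rewrite <- sum_n_psum. apply (sum_n_ext (G := C_AbelianMonoid)). intros k.
    rewrite <- pow_n_Cpow. reflexivity. }
  split; apply cvg_C_ext_loc; exists 0%nat; intros n _; now rewrite E.
Qed.

(** Near [s] write [w + c = (s + c) + (w - s)]: the first part scales the coefficients and the
    second shifts them. *)
Lemma analytic_affine_mult (f : C -> C) (c s : C) :
  analytic_at f s -> analytic_at (fun w => ((w + c) * f w)%C) s.
Proof.
  intros [a [r [Hr Ha]]].
  exists (PS_plus (V := C_NormedModule) (PS_scal (K := C_AbsRing) (V := C_NormedModule) (s + c)%C a)
    (PS_incr_1 (V := C_NormedModule) a)), r.
  split; trivial. intros w Hw. specialize (Ha w Hw).
  replace ((w + c) * f w)%C with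
    (plus (G := C_NormedModule) (scal (s + c)%C (f w)) (scal (w - s)%C (f w))).
  - apply (is_pseries_plus (V := C_NormedModule)).
    + apply (is_pseries_scal (V := C_NormedModule)); [apply Cmult_comm | exact Ha].
    + apply (is_pseries_incr_1 (V := C_NormedModule)). exact Ha.
  - change ((s + c) * f w + (w - s) * f w = (w + c) * f w)%C. ring.
Qed.

Lemma analytic_plus (f g : C -> C) (s : C) :
  analytic_at f s -> analytic_at g s -> analytic_at (fun w => (f w + g w)%C) s.
Proof.
  intros [a [r [Hr Ha]]] [b [q [Hq Hb]]].
  exists (PS_plus (V := C_NormedModule) a b), (Rmin r q).
  split; [now apply Rmin_glb_lt |]. intros w Hw.
  apply (is_pseries_plus (V := C_NormedModule)).
  - apply Ha. apply Rlt_le_trans with (1 := Hw), Rmin_l.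
  - apply Hb. apply Rlt_le_trans with (1 := Hw), Rmin_r.
Qed.

Lemma analytic_scal (f : C -> C) (c s : C) :
  analytic_at f s -> analytic_at (fun w => (c * f w)%C) s.
Proof.
  intros [a [r [Hr Ha]]].
  exists (PS_scal (K := C_AbsRing) (V := C_NormedModule) c a), r.
  split; trivial. intros w Hw.
  apply (is_pseries_scal (V := C_NormedModule)); [apply Cmult_comm | now apply Ha].
Qed.

Lemma analytic_const (c s : C) : analytic_at (fun _ => c) s.
Proof.
  exists (fun n => match n with O => c | S _ => RtoC 0 end), 1. split; [lra |].
  intros w _. apply analytic_cvg. apply cvg_C_ext_loc with (2 := cvg_C_const c).
  exists 0%nat. intros n _. induction n.
  - simpl. ring.
  - change (psum ?f (S (S n))) with (psum f (S n) + f (S n))%C. rewrite <- IHn. ring.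
Qed.

(** * Analyticity of the Euler-Maclaurin integral *)

Lemma RtoC_fact_neq_0 (n : nat) : RtoC (INR (fact n)) <> 0.
Proof. apply RtoC_neq_0, INR_fact_neq_0. Qed.

Definition exp_taylor (n : nat) (w : C) : C :=
  psum (fun k => w ^ k / RtoC (INR (fact k)))%C n.

(** The Taylor polynomials satisfy the integrated form of the differential equation of [exp],
    with a shift of the degree. *)
Lemma is_RInt_exp_taylor (n : nat) (w : C) (b : R) :
  is_RInt_C (fun v => (w * exp_taylor n (w * RtoC v))%C) 0 b (exp_taylor (S n) (w * RtoC b) - 1)%C.
Proof.
  induction n.
  - replace (exp_taylor 1 (w * RtoC b) - 1)%C with (RtoC 0) by (unfold exp_taylor; simpl; field).
    apply (is_RInt_ext (V := C_R_NormedModule)) with (2 := is_RInt_C_0 0 b).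
    intros v _. unfold exp_taylor. simpl. C_eq. ring.
  - replace (exp_taylor (S (S n)) (w * RtoC b) - 1)%C with
      ((exp_taylor (S n) (w * RtoC b) - 1)
       + (w ^ S n / RtoC (INR (fact n))) * RtoC (b ^ S n / INR (S n)))%C.
    + apply (is_RInt_ext (V := C_R_NormedModule)) with
        (fun v => (w * exp_taylor n (w * RtoC v) + w ^ S n / RtoC (INR (fact n)) * RtoC (v ^ n))%C).
      * intros v _. unfold exp_taylor. cbn [psum]. rewrite Cpow_mult_l, RtoC_pow.
        change (w ^ S n)%C with (w * w ^ n)%C. C_eq. field. apply RtoC_fact_neq_0.
      * apply is_RInt_C_plus; trivial. apply is_RInt_Cmult_l, is_RInt_RtoC, is_RInt_pow.
    + change (exp_taylor (S (S n)) (w * RtoC b))%C with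
        (exp_taylor (S n) (w * RtoC b) + (w * RtoC b) ^ S n / RtoC (INR (fact (S n))))%C.
      assert (Hn : INR (S n) <> 0) by (apply not_0_INR; lia).
      rewrite fact_simpl, mult_INR, RtoC_mult, Cpow_mult_l, RtoC_div, RtoC_pow by easy.
      apply RtoC_neq_0 in Hn. field. split; trivial. apply RtoC_fact_neq_0.
Qed.

Lemma exp_nondecreasing (a b : R) : a <= b -> exp a <= exp b.
Proof. intros [H | ->]; [left; now apply exp_increasing | right; reflexivity]. Qed.

(** Trading the usual [|w b| ^ n / n!] for the geometric factor [2 ^ (- n)] at the price of
    doubling the exponent gives a bound that reproduces itself under integration: the integral of
    [|w| exp (2 |w| v)] over [[0, b]] is less than [exp (2 |w| b) / 2]. *)
Lemma exp_taylor_bound (n : nat) (w : C) (b : R) : 0 <= b ->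
  Cmod (cexp (w * RtoC b) - exp_taylor n (w * RtoC b))%C <= (/ 2) ^ n * exp (2 * Cmod w * b).
Proof.
  revert b. induction n; intros b Hb.
  - unfold exp_taylor. simpl psum. unfold Cminus. rewrite Copp_0, Cplus_0_r, Cmod_cexp, Rmult_1_l.
    rewrite Re_mult, re_RtoC, im_RtoC, Rmult_0_r, Rminus_0_r.
    assert (Re w <= Cmod w) by (apply Rle_trans with (2 := re_le_Cmod w), Rle_abs).
    apply exp_nondecreasing. generalize (Cmod_ge_0 w). nra.
  - apply Rle_trans with ((/ 2) ^ S n * (exp (2 * Cmod w * b) - 1)).
    2:{ assert (0 < (/ 2) ^ S n) by (apply pow_lt; lra). lra. }
    apply Cmod_RInt_le with (fun v => (w * (cexp (w * RtoC v) - exp_taylor n (w * RtoC v)))%C)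
      (fun v => Cmod w * ((/ 2) ^ n * exp (2 * Cmod w * v))) 0 b; trivial.
    + intros v Hv. rewrite Cmod_mult. apply Rmult_le_compat_l; [apply Cmod_ge_0 | apply IHn; lra].
    + replace (cexp (w * RtoC b) - exp_taylor (S n) (w * RtoC b))%C
        with (minus (G := C_R_NormedModule) (cexp (w * RtoC b)) (cexp (w * RtoC 0))
              - (exp_taylor (S n) (w * RtoC b) - 1))%C.
      * apply (is_RInt_ext (V := C_R_NormedModule)) with
          (fun v => (w * cexp (w * RtoC v) - w * exp_taylor n (w * RtoC v))%C).
        { intros; C_eq; ring. }
        apply is_RInt_C_minus; [| apply is_RInt_exp_taylor].
        apply (is_RInt_derive (V := C_R_CompleteNormedModule) (fun v => cexp (w * RtoC v))).
        { intros; apply is_derive_cexp. }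
        intros v _. apply continuous_Cmult; [apply continuous_const |].
        apply (ex_derive_continuous (V := C_R_NormedModule)). eexists; apply is_derive_cexp.
      * rewrite Cmult_0_r, cexp_0. change (minus (cexp (w * RtoC b)) (RtoC 1))
          with (cexp (w * RtoC b) - 1)%C. ring.
    + replace ((/ 2) ^ S n * (exp (2 * Cmod w * b) - 1)) with
        ((/ 2) ^ S n * exp (2 * Cmod w * b) - (/ 2) ^ S n * exp (2 * Cmod w * 0))
        by (rewrite Rmult_0_r, exp_0; ring).
      apply (is_RInt_derive (V := R_CompleteNormedModule) (fun v => (/ 2) ^ S n * exp (2 * Cmod w * v))).
      * intros v _. auto_derive; trivial. simpl. field.
      * intros v _. apply (ex_derive_continuous (V := R_NormedModule)). auto_derive. trivial.
Qed.

Lemma pow_fact_le_exp (n : nat) (x : R) : 0 <= x -> x ^ n / INR (fact n) <= exp x.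
Proof.
  intros Hx. apply Rle_trans with (2 := exp_ge_taylor x n Hx).
  destruct n; [right; reflexivity |]. rewrite tech5.
  assert (0 <= sum_f_R0 (fun k => x ^ k / INR (fact k)) n); [| lra].
  apply cond_pos_sum. intros k. apply Rdiv_le_0_compat; [now apply pow_le | apply INR_fact_lt_0].
Qed.

(** The integrand of the [n]-th Taylor coefficient of [EM_integral] at [s], that is the coefficient
    of [z ^ n] in [B2per u * u ^ (- (s + z) - 2)]. *)
Definition EM_coef (s : C) (n : nat) (u : R) : C :=
  (RtoC (B2per u) * (cpow u (- s - 1 - 1) * ((- (1) * RtoC (ln u)) ^ n / RtoC (INR (fact n)))))%C.

Lemma ex_RInt_EM_coef (s : C) (n : nat) (y : R) : 1 <= y -> ex_RInt_C (EM_coef s n) 1 y.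
Proof.
  intros Hy. apply ex_RInt_B2per; trivial. intros u Hu.
  apply continuous_Cmult; [apply continuous_cpow; lra |].
  apply continuous_Cmult; [| apply continuous_const].
  apply continuous_Cpow, continuous_Cmult; [apply continuous_const |].
  apply continuous_RtoC, (ex_derive_continuous (V := R_NormedModule)). auto_derive. lra.
Qed.

Lemma cvg_EM_coef (s : C) (n : nat) : -1 < Re s ->
  cvg_C (fun N => RInt_C (EM_coef s n) 1 (INR N)) (improper_C (EM_coef s n)).
Proof.
  intros Hs. set (e := (Re s + 1) / 2). assert (He : 0 < e) by (unfold e; lra).
  apply improper_C_correct, ex_improper with (/ 4 * (/ e) ^ n) e; trivial.
  - apply Rmult_le_pos; [lra |]. apply pow_le. left. now apply Rinv_0_lt_compat.
  - apply ex_RInt_EM_coef.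
  - intros u Hu. assert (Hln : 0 <= ln u) by (rewrite <- ln_1; apply ln_le; lra).
    assert (Hf := INR_fact_lt_0 n).
    unfold EM_coef. rewrite Rmult_assoc, Cmod_mult.
    apply Rmult_le_compat; try apply Cmod_ge_0; [apply Cmod_B2per_le; lra |].
    rewrite Cmod_mult, Cmod_cpow, Cmod_div, Cmod_pow, Cmod_mult by apply RtoC_fact_neq_0.
    rewrite Cmod_m1, Rmult_1_l, !Cmod_R, (Rabs_pos_eq (ln u)), (Rabs_pos_eq (INR _)) by lra.
    replace (Re (- s - 1 - 1)) with (- e + (- e - 1)) by (unfold e, Re; simpl; field).
    rewrite (Rplus_comm (- e)), Rpower_plus.
    apply Rle_trans with (Rpower u (- e - 1) * Rpower u (- e) * ((/ e) ^ n * Rpower u e)).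
    (* [(ln u) ^ n / n! <= e ^ (- n) u ^ e], half of the decay of [u ^ (- 2 e)]. *)
    + apply Rmult_le_compat_l.
      * left. apply Rmult_lt_0_compat; apply Rpower_pos.
      * unfold Rpower. generalize (pow_fact_le_exp n (e * ln u) ltac:(nra)).
        rewrite Rpow_mult_distr. intros H.
        replace (ln u ^ n / INR (fact n)) with ((/ e) ^ n * (e ^ n * ln u ^ n / INR (fact n))).
        -- apply Rmult_le_compat_l; trivial. apply pow_le. left. now apply Rinv_0_lt_compat.
        -- rewrite pow_inv. field. split; [lra |]. apply pow_nonzero. lra.
    + right. rewrite Rpower_Ropp. field. apply Rgt_not_eq, Rpower_pos.
Qed.

Lemma EM_partial (s z : C) (N : nat) (u : R) : 0 < u ->
  (EM_integrand (s + z) u - psum (fun n => z ^ n * EM_coef s n u) N =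
   RtoC (B2per u) * cpow u (- s - 1 - 1)
     * (cexp (- z * RtoC (ln u)) - exp_taylor N (- z * RtoC (ln u))))%C.
Proof.
  intros Hu.
  assert (E : psum (fun n => (z ^ n * EM_coef s n u)%C) N
    = (RtoC (B2per u) * cpow u (- s - 1 - 1) * exp_taylor N (- z * RtoC (ln u)))%C).
  { induction N; unfold exp_taylor in *; cbn [psum]; [ring |]. rewrite IHN. unfold EM_coef.
    replace (- z * RtoC (ln u))%C with (z * (- (1) * RtoC (ln u)))%C by ring.
    rewrite !Cpow_mult_l. field. apply RtoC_fact_neq_0. }
  rewrite E. unfold EM_integrand. rewrite <- cpow_cexp.
  replace (- (s + z) - 1 - 1)%C with ((- s - 1 - 1) + - z)%C by ring.
  rewrite cpow_plus. ring.
Qed.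

Lemma ex_RInt_EM_partial (s z : C) (N : nat) (y : R) : 1 <= y ->
  ex_RInt_C (fun u => EM_integrand (s + z) u - psum (fun n => z ^ n * EM_coef s n u) N)%C 1 y.
Proof.
  intros Hy. induction N.
  - eexists. apply is_RInt_C_ext with (EM_integrand (s + z)); trivial.
    + intros; simpl; C_eq; ring.
    + now apply RInt_C_correct, ex_RInt_EM_integrand.
  - eexists. apply is_RInt_C_ext with (fun u => (EM_integrand (s + z) u
        - psum (fun n => z ^ n * EM_coef s n u) N) - z ^ N * EM_coef s N u)%C; trivial.
    + intros; simpl; C_eq; ring.
    + apply is_RInt_C_minus; [now apply RInt_C_correct |].
      now apply is_RInt_Cmult_l, RInt_C_correct, ex_RInt_EM_coef.
Qed.

Lemma cvg_EM_partial (s z : C) (N : nat) : -1 < Re s -> -1 < Re (s + z) ->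
  cvg_C (fun M => RInt_C (fun u => EM_integrand (s + z) u
           - psum (fun n => z ^ n * EM_coef s n u) N)%C 1 (INR M))
    (EM_integral (s + z) - psum (fun n => z ^ n * improper_C (EM_coef s n)) N)%C.
Proof.
  intros Hs Hsz. destruct (eventually_INR_ge 1) as [M0 HM0]. induction N.
  - simpl. replace (EM_integral (s + z) - 0)%C with (EM_integral (s + z)) by ring.
    apply cvg_C_ext_loc with (2 := cvg_EM_integral (s + z) Hsz).
    exists M0. intros M HM. specialize (HM0 M HM). symmetry. apply is_RInt_C_unique.
    apply is_RInt_C_ext with (EM_integrand (s + z)); trivial.
    + intros; simpl; C_eq; ring.
    + now apply RInt_C_correct, ex_RInt_EM_integrand.
  - simpl. replace (EM_integral (s + z) - (psum (fun n => z ^ n * improper_C (EM_coef s n)) N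
        + z ^ N * improper_C (EM_coef s N)))%C
      with ((EM_integral (s + z) - psum (fun n => z ^ n * improper_C (EM_coef s n)) N)
        - z ^ N * improper_C (EM_coef s N))%C by ring.
    apply cvg_C_ext_loc with (2 := cvg_C_minus _ _ _ _ IHN (cvg_C_mult_l (z ^ N)%C _ _ (cvg_EM_coef s N Hs))).
    exists M0. intros M HM. specialize (HM0 M HM). symmetry. apply is_RInt_C_unique.
    apply is_RInt_C_ext with (fun u => (EM_integrand (s + z) u
        - psum (fun n => z ^ n * EM_coef s n u) N) - z ^ N * EM_coef s N u)%C; trivial.
    + intros; simpl; C_eq; ring.
    + apply is_RInt_C_minus; [now apply RInt_C_correct, ex_RInt_EM_partial |].
      now apply is_RInt_Cmult_l, RInt_C_correct, ex_RInt_EM_coef.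
Qed.

(** Under [4 |z| < Re s + 1] the error of the expansion under the integral sign is at most
    [2 ^ (- n) u ^ (- e - 1) / 4] with [e = (Re s + 1) / 2], which is integrable uniformly in [n]. *)
Lemma EM_integral_expansion (s z : C) (N : nat) : -1 < Re s -> 4 * Cmod z < Re s + 1 ->
  Cmod (EM_integral (s + z) - psum (fun n => z ^ n * improper_C (EM_coef s n)) N)%C
  <= (/ 2) ^ N * (/ (2 * (Re s + 1))).
Proof.
  intros Hs Hz. set (e := (Re s + 1) / 2). assert (He : 0 < e) by (unfold e; lra).
  assert (Hsz : -1 < Re (s + z)).
  { assert (H := re_le_Cmod z). apply Rabs_le_between in H. simpl. unfold Re in *. lra. }
  assert (H2 : 0 <= (/ 2) ^ N) by (apply pow_le; lra).
  replace (EM_integral (s + z) - psum (fun n => z ^ n * improper_C (EM_coef s n)) N)%C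
    with (EM_integral (s + z) - psum (fun n => z ^ n * improper_C (EM_coef s n)) N - 0)%C by ring.
  replace ((/ 2) ^ N * (/ (2 * (Re s + 1)))) with ((/ 4 * (/ 2) ^ N) / e * Rpower 1 (- e)).
  2:{ unfold Rpower. rewrite ln_1, Rmult_0_r, exp_0. unfold e. field. lra. }
  refine (Cmod_improper_tail_le _ _ _ _ _ _ He _ (Rle_refl 1) (ex_RInt_EM_partial s z N) _
            (cvg_EM_partial s z N Hs Hsz) _).
  - lra.
  - intros u Hu. rewrite EM_partial by lra.
    assert (Hln : 0 <= ln u) by (rewrite <- ln_1; apply ln_le; lra).
    rewrite !Cmod_mult, Cmod_cpow.
    replace (Re (- s - 1 - 1)) with (- e + (- e - 1)) by (unfold e, Re; simpl; field).
    rewrite Rpower_plus.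
    generalize (exp_taylor_bound N (- z) (ln u) Hln). rewrite Cmod_opp. intros HT.
    assert (HT2 : exp (2 * Cmod z * ln u) <= Rpower u e).
    { unfold Rpower. apply exp_nondecreasing. unfold e. nra. }
    generalize (Rpower_pos u (- e)) (Rpower_pos u (- e - 1)); intros P1 P2.
    apply Rle_trans with (/ 4 * (Rpower u (- e) * Rpower u (- e - 1)) * ((/ 2) ^ N * Rpower u e)).
    + apply Rmult_le_compat; try apply Cmod_ge_0.
      * apply Rmult_le_pos; [apply Cmod_ge_0 | nra].
      * apply Rmult_le_compat_r; [nra | apply Cmod_B2per_le; lra].
      * apply Rle_trans with (1 := HT). now apply Rmult_le_compat_l.
    + right. rewrite Rpower_Ropp. field. apply Rgt_not_eq, Rpower_pos.
  - generalize (is_RInt_point (V := C_R_NormedModule) (fun u => EM_integrand (s + z) u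
           - psum (fun n => z ^ n * EM_coef s n u) N)%C 1). intros H; exact H.
Qed.

Lemma analytic_EM_integral (s : C) : -1 < Re s -> analytic_at EM_integral s.
Proof.
  intros Hs. exists (fun n => improper_C (EM_coef s n)), ((Re s + 1) / 4). split; [lra |].
  intros w Hw. apply analytic_cvg.
  assert (H0 : is_lim_seq (fun n => (/ 2) ^ S n * / (2 * (Re s + 1))) 0).
  { replace (Finite 0) with (Rbar_mult 0 (/ (2 * (Re s + 1)))) by (simpl; f_equal; ring).
    apply is_lim_seq_scal_r. apply (is_lim_seq_incr_1 (fun n => (/ 2) ^ n)).
    apply is_lim_seq_geom. rewrite Rabs_pos_eq; lra. }
  apply cvg_C_squeeze with (2 := H0). exists 0%nat. intros n _.
  replace (EM_integral w) with (EM_integral (s + (w - s))) by (f_equal; ring).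
  rewrite <- Cmod_opp.
  replace (- (psum (fun k => (w - s) ^ k * improper_C (EM_coef s k)) (S n) - EM_integral (s + (w - s))))%C
    with (EM_integral (s + (w - s))
          - psum (fun k => (w - s) ^ k * improper_C (EM_coef s k)) (S n))%C by ring.
  apply EM_integral_expansion; [easy | lra].
Qed.

(** * The identity theorem along a line *)

Lemma CV_radius_ge (a : nat -> R) (r : R) : 0 <= r -> ex_pseries a r -> Rbar_le r (CV_radius a).
Proof.
  intros Hr [l Hl]. apply Rbar_not_lt_le. intros H.
  apply (CV_disk_outside a r).
  - now rewrite Rabs_pos_eq.
  - apply ex_series_lim_0. exists l. now apply is_pseries_R.
Qed.

(** By continuity the constant term is the limit of the values at the right of [0]. *)
Lemma PSeries_zero_right_0 (a : nat -> R) (r : R) : 0 < r ->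
  Rbar_lt 0 (CV_radius a) -> (forall d, 0 < d < r -> PSeries a d = 0) -> a 0%nat = 0.
Proof.
  intros Hr Ha H0.
  - assert (Hc : continuity_pt (PSeries a) 0) by (apply PSeries_continuity; now rewrite Rabs_R0).
    destruct (Req_dec (a 0%nat) 0) as [E | E]; trivial. exfalso.
    destruct (Hc (Rabs (a 0%nat)) (Rabs_pos_lt _ E)) as [e [He Hd]].
    set (d := Rmin e r / 2).
    assert (Hmin : 0 < Rmin e r) by now apply Rmin_glb_lt.
    generalize (Rmin_l e r) (Rmin_r e r); intros M1 M2.
    specialize (Hd d). simpl in Hd. unfold R_dist in Hd.
    rewrite PSeries_0, (H0 d), Rminus_0_l, Rabs_Ropp in Hd by (unfold d; lra).
    apply (Rlt_irrefl (Rabs (a 0%nat))), Hd. split.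
    + split; [exact I | unfold d; lra].
    + rewrite Rminus_0_r, Rabs_pos_eq; unfold d; lra.
Qed.

(** A zero constant term can be divided out by the variable, after which the next coefficient is
    the constant term of a series that still vanishes at the right of [0]. *)
Lemma PSeries_zero_right (a : nat -> R) (r : R) (n : nat) : 0 < r ->
  Rbar_lt 0 (CV_radius a) -> (forall d, 0 < d < r -> PSeries a d = 0) -> a n = 0.
Proof.
  intros Hr. revert a. induction n; intros a Ha H0.
  - now apply PSeries_zero_right_0 with r.
  - apply (IHn (PS_decr_1 a)).
    + now rewrite CV_radius_decr_1.
    + intros d Hd. assert (E := H0 d Hd).
      rewrite PSeries_decr_1_aux in E by now apply PSeries_zero_right_0 with r.
      apply Rmult_integral in E. lra.
Qed.

Definition real_analytic_at (f : R -> R) (t : R) : Prop :=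
  exists (a : nat -> R) (r : R), 0 < r /\
    forall d, Rabs d < r -> is_pseries (K := R_AbsRing) (V := R_NormedModule) a d (f (t + d)).

(** All coefficients at [t] vanish because [f] does so at the right of [t]; the expansion then
    also holds at the left of [t]. *)
Lemma real_analytic_zero_left (f : R -> R) (t : R) :
  real_analytic_at f t -> (forall u, t < u -> f u = 0) ->
  exists r, 0 < r /\ forall u, t - r < u -> f u = 0.
Proof.
  intros [a [r [Hr Ha]]] H0. exists r. split; trivial. intros u Hu.
  destruct (Rlt_dec t u) as [Htu | Htu]; [now apply H0 |].
  assert (Ha0 : forall n, a n = 0).
  { intros n. apply PSeries_zero_right with r; trivial.
    - apply Rbar_lt_le_trans with (r / 2); [simpl; lra |].
      apply CV_radius_ge; [lra |]. eexists. apply Ha. rewrite Rabs_pos_eq; lra.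
    - intros d Hd. rewrite (is_pseries_unique _ _ (f (t + d))).
      + apply H0. lra.
      + apply Ha. rewrite Rabs_pos_eq; lra. }
  replace u with (t + (u - t)) by ring.
  rewrite <- (is_pseries_unique a (u - t) (f (t + (u - t)))).
  - rewrite (PSeries_ext a (fun _ => 0)) by easy. apply PSeries_const_0.
  - apply Ha. apply Rabs_def1; lra.
Qed.

(** The zero set, a half-line that reaches [1], extends to the left as long as [f] is analytic at
    its left end. *)
Lemma real_analytic_identity (f : R -> R) :
  (forall t, 0 <= t <= 1 -> real_analytic_at f t) -> (forall t, 1 <= t -> f t = 0) -> f 0 = 0.
Proof.
  intros Ha H1.
  (* Measured from 1 to the left, how far the zero set extends. *)
  set (E := fun x => x <= 1 /\ forall t, 1 - x <= t -> f t = 0).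
  destruct (completeness E) as [l [Hub Hlub]].
  - exists 1. intros x [Hx _]. exact Hx.
  - exists 0. split; [lra |]. intros t Ht. apply H1. lra.
  - assert (Hl0 : 0 <= l). { apply Hub. split; [lra |]. intros t Ht. apply H1. lra. }
    assert (Hl1 : l <= 1). { apply Hlub. intros x [Hx _]. exact Hx. }
    destruct (real_analytic_zero_left f (1 - l)) as [r [Hr H]].
    + apply Ha. lra.
    + intros u Hu. destruct (classic (exists x, E x /\ 1 - u < x)) as [[x [[_ Hx] Hux]] | Hno].
      * apply Hx. lra.
      * exfalso. assert (l <= 1 - u); [| lra]. apply Hlub. intros x Hx.
        apply Rnot_lt_le. intros Hlt. apply Hno. now exists x.
    + destruct (Rle_dec 1 (l + r / 2)) as [Hle | Hgt]; [apply H; lra |].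
      exfalso. assert (l + r / 2 <= l); [| lra]. apply Hub. split; [lra |].
      intros t Ht. apply H. lra.
Qed.

(** [L] is the real or the imaginary part: power series along a real line are then power series
    with real coefficients. *)
Lemma analytic_line (L : C -> R) (f : C -> C) (p w : C) (t : R) :
  (forall a b, L (a + b)%C = L a + L b) -> (forall r a, L (RtoC r * a)%C = r * L a) ->
  (forall a, Rabs (L a) <= Cmod a) ->
  analytic_at f (p + RtoC t * w) -> real_analytic_at (fun u => L (f (p + RtoC u * w)%C)) t.
Proof.
  intros Ladd Lscal Lle [a [r [Hr Ha]]].
  exists (fun n => L (w ^ n * a n)%C), (r / (Cmod w + 1)).
  assert (Hw := Cmod_ge_0 w).
  split; [apply Rdiv_lt_0_compat; lra |]. intros d Hd.
  apply is_pseries_R.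
  assert (Hz : (p + RtoC (t + d) * w - (p + RtoC t * w))%C = (RtoC d * w)%C)
    by (rewrite RtoC_plus; ring).
  specialize (Ha (p + RtoC (t + d) * w)%C). rewrite Hz in Ha.
  rewrite analytic_cvg in Ha.
  assert (Hdw : Cmod (RtoC d * w) < r).
  { rewrite Cmod_mult, Cmod_R. apply Rlt_div_r in Hd; [| lra].
    generalize (Rabs_pos d). nra. }
  specialize (Ha Hdw).
  assert (L0 : L 0 = 0).
  { rewrite <- (Cmult_0_l 0). rewrite Lscal. ring. }
  apply is_lim_seq_near with (2 := Ha). intros n.
  assert (E : forall n, sum_n (fun k => L (w ^ k * a k)%C * d ^ k) n
    = L (psum (fun k => ((RtoC d * w) ^ k * a k)%C) (S n))).
  { induction n0.
    - rewrite sum_O. simpl. rewrite Ladd, L0. rewrite !Cmult_1_l. ring.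
    - rewrite sum_Sn, IHn0.
      change (psum (fun k => (RtoC d * w) ^ k * a k) (S (S n0)))%C with
        (psum (fun k => (RtoC d * w) ^ k * a k) (S n0) + (RtoC d * w) ^ (S n0) * a (S n0))%C.
      rewrite Ladd, Cpow_mult_l, <- RtoC_pow, <- Cmult_assoc, Lscal.
      match goal with |- plus ?x ?y = ?z => change (x + y = z) end. ring. }
  rewrite E.
  assert (Lsub : forall a b, L (a - b)%C = L a - L b).
  { intros x y. replace (x - y)%C with (x + RtoC (-1) * y)%C
      by (change (RtoC (-1)) with (RtoC (- (1))); rewrite RtoC_opp; ring).
    rewrite Ladd, Lscal. ring. }
  rewrite <- Lsub. apply Lle.
Qed.

(** * Zeta for real part above -1 *)

(** Written with the operations that [analytic_affine_mult], [analytic_plus] and [analytic_scal]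
    treat, so that analyticity off [1] can be read off; that it vanishes for [Re s > -1] is [zeta_EM]. *)
Definition EM_defect (zeta : C -> C) (w : C) : C :=
  ((w + - (1)) * ((w + 0) * ((w + 1) * EM_integral w))
   + (- (1) * ((w + 1) * 1) + 2 * ((w + - (1)) * zeta w)))%C.

Lemma analytic_EM_defect (zeta : C -> C) (w : C) : is_riemann_zeta zeta ->
  -1 < Re w -> w <> 1 -> analytic_at (EM_defect zeta) w.
Proof.
  intros [Hz _] Hw Hw1. unfold EM_defect. apply analytic_plus.
  - do 3 apply analytic_affine_mult. now apply analytic_EM_integral.
  - apply analytic_plus; apply analytic_scal.
    + apply analytic_affine_mult, analytic_const.
    + apply analytic_affine_mult. now apply Hz.
Qed.

(** Analytic continuation of [zeta_EM_right] along a line that ends in [Re s > 1]. *)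
Lemma zeta_EM (zeta : C -> C) (s : C) : is_riemann_zeta zeta -> -1 < Re s -> s <> 1 ->
  ((s - 1) * s * (s + 1) * EM_integral s = (s + 1) - 2 * ((s - 1) * zeta s))%C.
Proof.
  intros Hz Hs Hs1.
  destruct s as [a b]. change (Re (a, b)) with a in Hs.
  (* The real part increases by 3 along the segment, from more than -1 to more than 1, and the
     imaginary part moves away from 0, so that the point 1 is avoided. *)
  set (w := (3, if Rle_dec 0 b then 1 else -1) : C).
  assert (Hne : forall t, 0 <= t -> ((a, b) + RtoC t * w)%C <> 1).
  { intros t Ht E.
    assert (E1 := f_equal fst E). assert (E2 := f_equal snd E). unfold w in E1, E2. simpl in E1, E2.
    assert (t = 0) by (destruct (Rle_dec 0 b); lra). subst t.
    apply Hs1. apply C_ext; simpl; lra. }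
  assert (Hre : forall t, Re ((a, b) + RtoC t * w)%C = a + 3 * t).
  { intros t. unfold w, Re. simpl. ring. }
  assert (Han : forall t, 0 <= t <= 1 -> analytic_at (EM_defect zeta) ((a, b) + RtoC t * w)%C).
  { intros t Ht. apply analytic_EM_defect; trivial; [rewrite Hre; lra | apply Hne; lra]. }
  assert (H0 : forall t, 1 <= t -> EM_defect zeta ((a, b) + RtoC t * w)%C = 0).
  { intros t Ht. set (z := ((a, b) + RtoC t * w)%C).
    assert (Hz1 : 1 < Re z) by (unfold z; rewrite Hre; lra).
    assert (E := zeta_EM_right zeta z Hz Hz1). unfold EM_defect.
    replace ((z + - (1)) * ((z + 0) * ((z + 1) * EM_integral z)))%C
      with ((z - 1) * z * (z + 1) * EM_integral z)%C by ring.
    rewrite E. ring. }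
  assert (E : EM_defect zeta (a, b) = 0).
  { replace (a, b) with ((a, b) + RtoC 0 * w)%C by ring.
    apply C_ext.
    - apply (real_analytic_identity (fun u => Re (EM_defect zeta ((a, b) + RtoC u * w)%C))).
      + intros t Ht. apply (analytic_line Re); auto.
        * intros; apply re_scal_l.
        * apply re_le_Cmod.
      + intros t Ht. now rewrite H0.
    - apply (real_analytic_identity (fun u => Im (EM_defect zeta ((a, b) + RtoC u * w)%C))).
      + intros t Ht. apply (analytic_line Im); auto.
        * intros; apply im_scal_l.
        * apply Im_le_Cmod.
      + intros t Ht. now rewrite H0. }
  apply Ceq_minus. rewrite <- E. unfold EM_defect. ring.
Qed.

(** Subtracting [B2per t] times the integral of [u ^ (- s - 2)] over [u >= t] removes the boundary
    term of the summation and leaves the integrand [(B2per u - B2per t) * u ^ (- s - 2)], in which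
    the difference is at most [1 / 4]. *)
Lemma rem_bound (zeta : C -> C) (s : C) (t : R) : is_riemann_zeta zeta -> s <> 1 ->
  -1 < Re s -> 1 <= t ->
  Cmod (rem zeta s t) <= Cmod (s + 1) / (Re s + 1) * (Cmod (s - 1) * Cmod s / 8) * / t.
Proof.
  intros Hz Hs1 Hs Ht.
  assert (Hs1' : (s + 1)%C <> 0).
  { intros E. assert (E1 := f_equal Re E). unfold Re in *. simpl in E1. lra. }
  set (p := RtoC (B2per t)).
  (* The division by [- s - 1] undoes the factor that [is_RInt_cpow] carries. *)
  set (h := fun u => (EM_integrand s u - p / (- s - 1) * ((- s - 1) * cpow u (- s - 1 - 1)))%C).
  assert (Hm : (- s - 1)%C <> 0).
  { intros E. apply Hs1'. replace (s + 1)%C with (- (- s - 1))%C by ring. rewrite E. ring. }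
  assert (Hh : forall y, 1 <= y -> is_RInt_C h 1 y
    (RInt_C (EM_integrand s) 1 y - p / (- s - 1) * (cpow y (- s - 1) - cpow 1 (- s - 1)))%C).
  { intros y Hy. apply is_RInt_C_minus.
    - now apply RInt_C_correct, ex_RInt_EM_integrand.
    - apply is_RInt_Cmult_l, is_RInt_cpow; lra. }
  assert (Hlim : cvg_C (fun n => RInt_C h 1 (INR n))
    (EM_integral s - p / (- s - 1) * (0 - cpow 1 (- s - 1)))%C).
  { apply cvg_C_ext_loc with (fun n => (RInt_C (EM_integrand s) 1 (INR n)
      - p / (- s - 1) * (cpow (INR n) (- s - 1) - cpow 1 (- s - 1)))%C).
    - destruct (eventually_INR_ge 1) as [N HN]. exists N. intros n Hn. specialize (HN n Hn).
      symmetry. now apply is_RInt_C_unique, Hh.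
    - apply cvg_C_minus; [now apply cvg_EM_integral |].
      apply cvg_C_mult_l, cvg_C_minus; [| apply cvg_C_const].
      apply cvg_cpow_neg. unfold Re in *. simpl. lra. }
  assert (Hb : forall u, t <= u -> Cmod (h u) <= / 4 * Rpower u (- (Re s + 1) - 1)).
  { intros u Hu.
    replace (h u) with ((RtoC (B2per u) - p) * cpow u (- s - 1 - 1))%C
      by (unfold h, EM_integrand; field; easy).
    rewrite Cmod_mult, Cmod_cpow.
    replace (Re (- s - 1 - 1)) with (- (Re s + 1) - 1) by (unfold Re; simpl; ring).
    apply Rmult_le_compat_r; [left; apply Rpower_pos |].
    unfold p. rewrite <- RtoC_minus, Cmod_R.
    destruct (B2per_bounds u) as [B1 B2]; [lra |]. destruct (B2per_bounds t) as [B3 B4]; [lra |].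
    apply Rabs_le. split; lra. }
  assert (Htail : Cmod ((EM_integral s - p / (- s - 1) * (0 - cpow 1 (- s - 1)))
     - (RInt_C (EM_integrand s) 1 t - p / (- s - 1) * (cpow t (- s - 1) - cpow 1 (- s - 1))))%C
     <= / 4 / (Re s + 1) * Rpower t (- (Re s + 1))).
  { apply (Cmod_improper_tail_le h); trivial; try lra.
    - intros y Hy. eexists. now apply Hh.
    - now apply Hh. }
  set (T := ((EM_integral s - p / (- s - 1) * (0 - cpow 1 (- s - 1)))
     - (RInt_C (EM_integrand s) 1 t - p / (- s - 1) * (cpow t (- s - 1) - cpow 1 (- s - 1))))%C) in *.
  assert (HE : ((s - 1) * s * (s + 1) * RInt_C (EM_integrand s) 1 t =
    2 * EM_boundary s t + (s + 1) - s * (s - 1) * RtoC (B2per t) * cpow t (- s - 1))%C).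
  { rewrite <- (is_RInt_C_unique _ _ _ _ (is_RInt_Cmult_l ((s - 1) * s * (s + 1)) _ _ _ _
      (RInt_C_correct _ _ _ (ex_RInt_EM_integrand s _ Ht)))).
    now apply is_RInt_C_unique, is_RInt_B2per_cpow. }
  assert (HZ := zeta_EM zeta s Hz Hs Hs1).
  assert (Hrem : rem zeta s t = (cpow t s * (- (1) / 2 * ((s - 1) * s * (s + 1) * T)))%C).
  { rewrite rem_EM_boundary by easy. f_equal.
    transitivity (- (1) / 2 * ((s - 1) * s * (s + 1) * EM_integral s
      - (s - 1) * s * (s + 1) * RInt_C (EM_integrand s) 1 t
      - s * (s - 1) * p * cpow t (- s - 1)))%C.
    - rewrite HE, HZ. fold p. field.
    - unfold T. field. easy. }
  rewrite Hrem, !Cmod_mult, Cmod_cpow, Cmod_div by (apply RtoC_neq_0; lra).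
  rewrite Cmod_m1, Cmod_R, (Rabs_pos_eq 2) by lra.
  assert (HK : 0 <= Cmod (s - 1) * Cmod s * Cmod (s + 1))
    by (repeat apply Rmult_le_pos; apply Cmod_ge_0).
  apply Rle_trans with (Rpower t (Re s) * (1 / 2 * (Cmod (s - 1) * Cmod s * Cmod (s + 1)
    * (/ 4 / (Re s + 1) * Rpower t (- (Re s + 1)))))).
  - apply Rmult_le_compat_l; [left; apply Rpower_pos |].
    apply Rmult_le_compat_l; [lra |]. now apply Rmult_le_compat_l.
  - right.
    assert (Hp : Rpower t (Re s) * Rpower t (- (Re s + 1)) = / t).
    { rewrite <- Rpower_plus. replace (Re s + - (Re s + 1)) with (- (1)) by ring.
      rewrite Rpower_Ropp, Rpower_1; lra. }
    rewrite <- Hp. field. lra.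
Qed.

(** * Zeta does not vanish on the real axis above -1 *)

Lemma Re_EM_integral_le_0 (sigma : R) : -1 < sigma -> Re (EM_integral sigma) <= 0.
Proof.
  intros Hs.
  assert (Hlim : is_lim_seq (fun n => Re (RInt_C (EM_integrand sigma) 1 (INR n))) (Re (EM_integral sigma))).
  { apply is_lim_seq_near with (2 := cvg_EM_integral sigma Hs).
    intros n. apply (re_le_Cmod (RInt_C (EM_integrand sigma) 1 (INR n) - EM_integral sigma)). }
  assert (H : Rbar_le (Re (EM_integral sigma)) 0); [| exact H].
  apply is_lim_seq_le_loc with (2 := Hlim) (3 := is_lim_seq_const 0).
  destruct (eventually_INR_ge 1) as [N HN]. exists N. intros n Hn. specialize (HN n Hn).
  replace 0 with ((INR n - 1) * 0) by ring.
  apply (is_RInt_le (fun u => Re (EM_integrand sigma u)) (fun _ => 0) 1 (INR n)); trivial.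
  - now apply is_RInt_Re, RInt_C_correct, ex_RInt_EM_integrand.
  - apply (is_RInt_const (V := R_NormedModule)).
  - intros u Hu. unfold EM_integrand.
    rewrite <- RtoC_opp, <- !RtoC_minus, cpow_real, <- RtoC_mult, re_RtoC.
    destruct (B2per_bounds u) as [_ H]; [lra |].
    generalize (Rpower_pos u (- sigma - 1 - 1)). nra.
Qed.

(** If [zeta sigma = 0] then [(sigma - 1) sigma F sigma = 1].  As [F sigma <= 0], this forces
    [0 < sigma < 1], where the left side is at most [1 / 4 * 1 / 4]. *)
Lemma zeta_neq_0 (zeta : C -> C) (sigma : R) : is_riemann_zeta zeta -> sigma <> 1 ->
  -1 < sigma -> zeta sigma <> 0.
Proof.
  intros Hz Hs1 Hs E.
  assert (Hs1' : RtoC sigma <> 1) by (intros H; now apply RtoC_inj in H).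
  assert (H := zeta_EM zeta sigma Hz Hs Hs1'). rewrite E in H.
  assert (HF : (sigma - 1) * sigma * (sigma + 1) * Re (EM_integral sigma) = sigma + 1).
  { apply (f_equal Re) in H.
    rewrite <- re_scal_l, !RtoC_mult, RtoC_plus, RtoC_minus, H. unfold Re; simpl. ring. }
  assert (HF1 : (sigma - 1) * sigma * Re (EM_integral sigma) = 1).
  { apply Rmult_eq_reg_l with (sigma + 1); [| lra]. rewrite <- Rmult_assoc in *. lra. }
  assert (H0 := Re_EM_integral_le_0 sigma Hs).
  assert (Hb : - / 4 <= (sigma + 1) * Re (EM_integral sigma)).
  { assert (HB : Cmod (EM_integral sigma - 0) <= / 4 / (sigma + 1) * Rpower 1 (- (sigma + 1))).
    { apply (Cmod_improper_tail_le (EM_integrand sigma)); try lra.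
      - apply ex_RInt_EM_integrand.
      - apply Cmod_EM_integrand_le.
      - now apply cvg_EM_integral.
      - apply (is_RInt_point (V := C_R_NormedModule)). }
    unfold Rpower in HB. rewrite ln_1, Rmult_0_r, exp_0, Rmult_1_r in HB.
    unfold Cminus in HB. rewrite Copp_0, Cplus_0_r in HB.
    apply (Rle_trans _ _ _ (re_le_Cmod _)), Rabs_le_between in HB.
    destruct HB as [HB _]. apply Rmult_le_compat_l with (r := sigma + 1) in HB; [| lra].
    replace ((sigma + 1) * - (/ 4 / (sigma + 1))) with (- / 4) in HB by (field; lra). exact HB. }
  destruct (Rle_dec sigma 0); [nra |]. destruct (Rle_dec 1 sigma); nra.
Qed.

(** * The estimate for real exponents *)

Definition m_partial (n : nat) : R :=
  sum_n_m (G := R_AbelianMonoid) (fun k => moebius k / INR k) 1 n.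

(** Abel summation presents [|m|], which is not itself a sum over [n <= x] of given terms, as one. *)
Definition abs_m_jump (k : nat) : C := RtoC (Rabs (m_partial k) - Rabs (m_partial (pred k))).

Lemma abs_m_step (u : R) : RtoC (Rabs (m u)) = sum_C abs_m_jump 1 (floor_nat u).
Proof.
  change (m u) with (m_partial (floor_nat u)). induction (floor_nat u) as [| n IHn].
  - rewrite sum_C_0. unfold m_partial. rewrite sum_n_m_zero by lia. f_equal. apply Rabs_R0.
  - rewrite sum_C_S, <- IHn. unfold abs_m_jump. simpl pred. rewrite RtoC_minus. C_eq. ring.
Qed.

(** The substitution [u = x / t], carried out on each jump of [|m|] since the integrand is not
    continuous: the jump at [k] contributes [(1 - (k / x) ^ 2) / 2] on the left and
    [(x ^ 2 - k ^ 2) / 2] on the right. *)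
Lemma is_RInt_abs_m_inv (x : R) : 1 <= x ->
  is_RInt (fun t => Rabs (m (x / t)) * / t ^ 3) 1 x
    (/ x ^ 2 * RInt (fun u => Rabs (m u) * u) 1 x).
Proof.
  intros Hx.
  set (A := sum_C (fun k => abs_m_jump k * RtoC ((x ^ 2 - INR k ^ 2) / 2))%C 1 (floor_nat x)).
  assert (H1 : is_RInt (fun u => Rabs (m u) * u) 1 x (Re A)).
  { apply (is_RInt_ext (V := R_NormedModule)) with
      (fun u => Re (sum_C abs_m_jump 1 (floor_nat u) * RtoC u)).
    - intros u _. now rewrite <- abs_m_step, <- RtoC_mult, re_RtoC.
    - apply is_RInt_Re, is_RInt_step; trivial. intros k _ _. apply is_RInt_RtoC, is_RInt_id. }
  rewrite (is_RInt_unique (V := R_CompleteNormedModule) _ _ _ _ H1).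
  rewrite <- re_scal_l. unfold A. rewrite <- sum_C_mult_l.
  apply (is_RInt_ext (V := R_NormedModule)) with
    (fun t => Re (sum_C abs_m_jump 1 (floor_nat (x / t)) * RtoC (/ t ^ 3))).
  - intros t _. now rewrite <- abs_m_step, <- RtoC_mult, re_RtoC.
  - rewrite (sum_C_ext _ (fun k => abs_m_jump k * RtoC (/ 2 * (1 - / (x / INR k) ^ 2)))%C).
    + apply is_RInt_Re, is_RInt_step_inv; trivial. intros k Hk1 Hk2.
      apply is_RInt_RtoC, is_RInt_inv_cube. apply INR_ge_1 in Hk1. apply Rle_div_r; lra.
    + intros k Hk. assert (1 <= INR k) by (apply INR_ge_1; lia).
      rewrite Cmult_assoc, (Cmult_comm (RtoC _)), <- Cmult_assoc, <- RtoC_mult.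
      do 2 f_equal. field. lra.
Qed.

Lemma Cmod_is_RInt_m_rem_le (zeta : C -> C) (s : C) (x K : R) (l : C) : 1 <= x ->
  (forall t, 1 <= t -> Cmod (rem zeta s t) <= K * / t) ->
  is_RInt_C (fun t => (RtoC (m (x / t)) * rem zeta s t / RtoC (t ^ 2))%C) 1 x l ->
  Cmod l <= K * (/ x ^ 2 * RInt (fun u => Rabs (m u) * u) 1 x).
Proof.
  intros Hx HK Hl.
  apply Cmod_RInt_le with (3 := Hl) (g := fun t => K * (Rabs (m (x / t)) * / t ^ 3)); trivial.
  - intros t Ht. rewrite Cmod_div, Cmod_mult, !Cmod_R by (apply RtoC_neq_0, pow_nonzero; lra).
    rewrite (Rabs_pos_eq (t ^ 2)) by (apply pow_le; lra).
    replace (K * (Rabs (m (x / t)) * / t ^ 3)) with (Rabs (m (x / t)) * (K * / t) / t ^ 2)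
      by (field; lra).
    apply Rmult_le_compat_r; [left; apply Rinv_0_lt_compat, pow_lt; lra |].
    apply Rmult_le_compat_l; [apply Rabs_pos | apply HK; lra].
  - apply (is_RInt_scal (V := R_NormedModule)). now apply is_RInt_abs_m_inv.
Qed.

Theorem proposition5 :
  forall zeta : C -> C, is_riemann_zeta zeta ->
  forall (s : C) (x : R), s <> RtoC 1 -> 1 <= x ->
  (zeta s * (mu_sum s x - RtoC (m x) / cpow x (s - 1)) - 1
   = s * (RtoC (m_check x) - 1) / cpow x (s - 1)
     - (s - 1) * RtoC (m1 x) / (2 * cpow x (s - 1))
     + (s - 1) / cpow x s
     + / cpow x (s - 1)
       * RInt (V := C_R_CompleteNormedModule)
           (fun t : R => RtoC (m (x / t)) * rem zeta s t / RtoC (t ^ 2)) 1 x)%C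
  /\
  (-1 < Re s ->
   forall t : R, 1 <= t ->
   Cmod (rem zeta s t)
   <= Cmod (s + 1)%C / Rabs (Re s + 1) * (Cmod (s - 1)%C * Cmod s / 6) * / t)
  /\
  (forall sigma : R, s = RtoC sigma -> -1 < sigma ->
   Cmod (mu_sum s x - / zeta s - RtoC (m x) / cpow x (s - 1))%C
   <= Rabs sigma * Rabs (sigma - 1) / (8 * Cmod (zeta s))
        * / Rpower x (sigma - 1) * / x ^ 2
        * RInt (fun t : R => Rabs (m t) * t) 1 x
      + / (Cmod (zeta s) * Rpower x (sigma - 1))
        * (Rabs (sigma - 1) / 2 * Rabs (m1 x)
           + Rabs sigma * Rabs (m_check x - 1)
           + Rabs (sigma - 1) / x)).
Proof.
  intros zeta Hz s x Hs1 Hx.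
  assert (Hi := zeta_mu_sum_identity zeta s x Hx).
  split; [exact Hi |]. split.
  - intros Hs t Ht. apply Rle_trans with (1 := rem_bound zeta s t Hz Hs1 Hs Ht).
    rewrite (Rabs_pos_eq (Re s + 1)) by lra.
    apply Rmult_le_compat_r; [left; apply Rinv_0_lt_compat; lra |].
    apply Rmult_le_compat_l.
    + apply Rdiv_le_0_compat; [apply Cmod_ge_0 | lra].
    + generalize (Rmult_le_pos _ _ (Cmod_ge_0 (s - 1)) (Cmod_ge_0 s)). lra.
  - intros sigma Es Hs.
    assert (Hsigma : sigma <> 1) by (intros E; apply Hs1; now rewrite Es, E).
    assert (Hzeta : zeta s <> 0) by (rewrite Es; now apply zeta_neq_0).
    assert (Hl := is_RInt_m_rem zeta s x Hx).
    rewrite (is_RInt_C_unique _ _ _ _ Hl) in Hi.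
    match type of Hl with is_RInt _ _ _ ?L => set (l := L) in * end.
    assert (Hb : Cmod l <= Rabs (sigma - 1) * Rabs sigma / 8
      * (/ x ^ 2 * RInt (fun u => Rabs (m u) * u) 1 x)).
    { apply Cmod_is_RInt_m_rem_le with (3 := Hl); trivial. intros t Ht.
      assert (Hre : Re s = sigma) by (now rewrite Es).
      assert (HB := rem_bound zeta s t Hz Hs1 ltac:(lra) Ht).
      rewrite Hre, Es, <- RtoC_plus, <- RtoC_minus, !Cmod_R, (Rabs_pos_eq (sigma + 1)) in HB by lra.
      rewrite Es. unfold Rdiv in HB at 1. rewrite Rinv_r, Rmult_1_l in HB by lra. exact HB. }
    assert (Hp := Rpower_pos x (sigma - 1)).
    assert (Hx0 : RtoC x <> 0) by (apply RtoC_neq_0; lra).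
    assert (HP : cpow x (s - 1) = Rpower x (sigma - 1)).
    { now rewrite Es, <- RtoC_minus, cpow_real. }
    set (P := Rpower x (sigma - 1)) in *.
    assert (HP0 : RtoC P <> 0) by (apply RtoC_neq_0; lra).
    rewrite (cpow_S x s), HP in Hi by lra. rewrite HP.
    replace (mu_sum s x - / zeta s - RtoC (m x) / RtoC P)%C
      with (/ (zeta s * RtoC P) * (l + (- (1) * ((s - 1) * (RtoC (m1 x) / 2))
        + s * (RtoC (m_check x) - 1) + (s - 1) / RtoC x)))%C.
    + rewrite Cmod_mult, Cmod_inv, Cmod_mult, Cmod_R, (Rabs_pos_eq P)
        by (lra || now apply Cmult_neq_0).
      assert (Hz0 : 0 < Cmod (zeta s)) by now apply Cmod_gt_0.
      replace (Rabs sigma * Rabs (sigma - 1) / (8 * Cmod (zeta s)) * / P * / x ^ 2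
        * RInt (fun t : R => Rabs (m t) * t) 1 x)
        with (/ (Cmod (zeta s) * P) * (Rabs (sigma - 1) * Rabs sigma / 8
          * (/ x ^ 2 * RInt (fun u => Rabs (m u) * u) 1 x))) by (field; lra).
      rewrite <- Rmult_plus_distr_l.
      apply Rmult_le_compat_l; [left; apply Rinv_0_lt_compat; nra |].
      apply Rle_trans with (1 := Cmod_triangle _ _), Rplus_le_compat; trivial.
      apply Rle_trans with (1 := Cmod_triangle _ _), Rplus_le_compat.
      * apply Rle_trans with (1 := Cmod_triangle _ _), Rplus_le_compat.
        -- right. rewrite Es, <- RtoC_minus, <- RtoC_div, !Cmod_mult, Cmod_m1, !Cmod_R by lra.
           unfold Rdiv. rewrite Rabs_mult, (Rabs_pos_eq (/ 2)) by lra. ring.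
        -- right. now rewrite Es, <- RtoC_minus, Cmod_mult, !Cmod_R.
      * right. rewrite Cmod_div, Es, <- RtoC_minus, !Cmod_R, (Rabs_pos_eq x) by (lra || easy). easy.
    + apply (f_equal (fun w => / zeta s * w)%C) in Hi.
      transitivity (/ zeta s * (zeta s * (mu_sum s x - RtoC (m x) / RtoC P) - 1))%C.
      * rewrite Hi. field. auto.
      * field. auto.
Qed.
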